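(* Assume: 1. the family $(\mathrm P_\theta^T,\ \theta\in\Theta)$, $T\ge 0$, where $\mathrm P_\theta^T$ is the distribution of $X_{(T)}=(X_t,\ 0\le t\le T)$ under $\mathrm P_\theta$, is LAN at every $\theta\in\Theta$ with rate $c_T=T^{-1/2}$ and asymptotic information matrix $I(\theta)$; 2. for every $\theta\in\Theta$ and for $\mu_\theta$-almost every $x\in E$, the family of estimators $\widehat r_T(x)$, $T\ge 0$, of $r(x,\theta)$ is regular at $\theta$ with a centered limit of finite variance, i.e. there is a centered distribution $L(x,\theta)$ on $\mathbb R^k$ with finite variance such that for all $u\in\mathbb R^d$, under $\mathrm P^T_{\theta+u/\sqrt T}$, the random vector $\sqrt T\big(\widehat r_T(x)-r(x,\theta+u/\sqrt T)\big)$ converges in distribution to $L(x,\theta)$ as $T\to\infty$. Then for all $\theta\in\Theta$ and all $y\in\mathbb R^k$, $$\liminf_{T\to\infty} T\, y'\rho_T(\theta)\,y\ \ge\ y'\left(\int_E (\mathrm J_\theta r(x,\theta))\, I(\theta)^{-1} (\mathrm J_\theta r(x,\theta))'\, d\mu_\theta(x)\right) y .$$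
   Context: Setting. $(X_t,\ t\in\mathcal T)$, with $\mathcal T=\mathbb N$ or $\mathbb R_+$, is a random process with values in a measurable space $(E,\mathcal B)$, with distribution $\mathrm P_\theta$, $\theta\in\Theta\subset\mathbb R^d$ unknown. At time $T$ the path $X_{(T)}=(X_t,\ 0\le t\le T)$ is observed. $(Y_t)$ is an $\mathbb R^k$-valued process, and $r(x,\theta)=\mathrm E_\theta(Y_T\mid X_T=x)$ is assumed not to depend on $T$. The function $(x,\theta)\mapsto r(x,\theta)\in\mathbb R^k$ is measurable and, for each $x\in E$, $\theta\mapsto r(x,\theta)$ is differentiable on $\Theta$ with Jacobian matrix $\mathrm J_\theta r(x,\theta)$ ($k\times d$). $\mu_\theta$ is a measure on $(E,\mathcal B)$ not depending on $T$, and $r(\cdot,\theta),\ \mathrm J_\theta r(\cdot,\theta)\in \mathrm L^2(\mu_\theta)$. $\widehat r_T$ is an estimator of the function $r(\cdot,\theta)$ based on $X_{(T)}$. Notation. $A'$ is the transpose, $A^{\times 2}=AA'$. The quadratic error of estimation of the regression function (QER) is $\rho_T(\theta)=\int_E \mathrm E_\theta\big(\widehat r_T(x)-r(x,\theta)\big)^{\times 2}\,d\mu_\theta(x)$. LAN. The family $(\mathrm P^T_\theta,\theta\in\Theta)$ is LAN at $\theta$ with rate $c_T\to0$ ($c_T>0$) if there are a symmetric positive definite matrix $I(\theta)$ and random vectors $\Delta_T(\theta)$ such that for all $u\in\mathbb R^d$, $\log\frac{d\mathrm P^T_{\theta+c_Tu}}{d\mathrm P^T_\theta}(X_{(T)})=u'\Delta_T(\theta)-\frac12u'I(\theta)u+\varepsilon_T(X_{(T)},\theta,u)$,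 where, under $\mathrm P_\theta^T$, $\Delta_T(\theta)$ converges in distribution to $\mathcal N(0,I(\theta))$ and $\varepsilon_T(X_{(T)},\theta,u)\to0$ in $\mathrm P_\theta$-probability as $T\to\infty$. (It is implicit that $\theta+c_Tu\in\Theta$ for $T$ large.) *)

(* Defs.v *)
From HB Require Import structures.
From mathcomp Require Import all_boot all_order all_algebra.
From mathcomp Require Import all_classical all_reals all_analysis measurable_realfun.
From mathcomp Require Import lra.
Import Order.TTheory GRing.Theory Num.Theory.
Import numFieldNormedType.Exports.

Set Implicit Arguments.
Unset Strict Implicit.
Unset Printing Implicit Defensive.

Local Open Scope classical_set_scope.
Local Open Scope ring_scope.

(* Vectors of R^k are columns. [borel_cV R k] is 'cV[R]_k with the sigma-algebra
   generated by the open sets. *)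
Notation borel_cV R k := (g_sigma_algebraType (@open 'cV[R]_k)).

Definition dotv {R : realType} (d : nat) (u z : 'cV[R]_d) : R := (u^T *m z) 0 0.

Definition quadform {R : realType} (d : nat) (S : 'M[R]_d) (u : 'cV[R]_d) : R :=
  (u^T *m S *m u) 0 0.

Definition at_infty {R : realType} (time : set R) : set_system R :=
  within time (pinfty_nbhs R).

Section trajectories.
Context {R : realType} (time : set R) {dE : measure_display} (E : measurableType dE).

Definition times_upto (T : R) : Type := {t : R | time t /\ 0 <= t <= T}.

(* E^{t in time, 0 <= t <= T} with the product sigma-algebra, generated by the
   cylinders with one-dimensional base. *)
Definition cylinders (T : R) : set (set (times_upto T -> E)) :=
  [set C | exists s : times_upto T, exists2 B, measurable B & C = [set w | B (w s)]].

Local Notation trajectory T := (g_sigma_algebraType (@cylinders T)).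

Context {dO : measure_display} {Omega : measurableType dO}.

Definition observed (X : R -> {mfun Omega >-> E}) (T : R) : Omega -> trajectory T :=
  fun w t => X (sval t) w.

Lemma measurable_observed (X : R -> {mfun Omega >-> E}) (T : R) :
  measurable_fun [set: Omega] (observed X (T := T)).
Proof.
apply: (@measurability _ _ _ (trajectory T) setT _ (@cylinders T)) => // _ [C [s [B mB ->]] <-].
have := @measurable_funPT _ _ _ _ (X (sval s)) measurableT B mB.
by rewrite setTI.
Qed.

HB.instance Definition _ (X : R -> {mfun Omega >-> E}) (T : R) :=
  isMeasurableFun.Build _ _ _ _ (observed X (T := T)) (@measurable_observed X T).

Definition trajectory_law (X : R -> {mfun Omega >-> E}) (P : probability Omega R) (T : R)
  : probability (trajectory T) R := distribution P (observed X (T := T)).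

End trajectories.

Notation trajectory time E T := (g_sigma_algebraType (@cylinders _ time _ E T)).

(* Convergence in distribution of Z_t to the law L, where Z_t is considered under
   P_t and the underlying spaces may vary with t. *)
Definition cvg_in_distribution {R : realType} (k : nat) (F : set_system R)
    {dW : R -> measure_display} {W : forall t, measurableType (dW t)}
    (P : forall t, probability (W t) R) (Z : forall t, W t -> 'cV[R]_k)
    (L : probability (borel_cV R k) R) : Prop :=
  forall f : 'cV[R]_k -> R, continuous f -> (exists M, forall z, `|f z| <= M) ->
    \int[P t]_w f (Z t w) @[t --> F] --> \int[L]_z f z.

(* N is N(0, S) for a positive definite S: every nonzero linear form u'z is
   distributed as N(0, u'Su); [normal_prob] takes the standard deviation. *)
Definition centered_gaussian {R : realType} (d : nat) (S : 'M[R]_d)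
    (N : probability (borel_cV R d) R) : Prop :=
  forall u : 'cV[R]_d, u != 0 -> forall A : set R, measurable A ->
    N [set z | A (dotv u z)] =
    normal_prob 0 (Num.sqrt (quadform S u)) A.

Definition centered_finite_variance {R : realType} (k : nat)
    (L : probability (borel_cV R k) R) : Prop :=
  forall i : 'I_k,
    (fun z : borel_cV R k => (z : 'cV[R]_k) i 0) \in Lfun L 2%:E /\
    ('E_L[fun z : borel_cV R k => (z : 'cV[R]_k) i ord0] = 0)%E.

(* f = dQ/dP, the density of the part of Q that is absolutely continuous with
   respect to P; N carries the singular part.  When Q is dominated by P this is
   the Radon-Nikodym derivative, see [likelihood_ratio_dominated]. *)
Definition likelihood_ratio {R : realType} {dW : measure_display}
    {W : measurableType dW} (P Q : probability W R) (f : W -> \bar R) : Prop :=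
  [/\ measurable_fun [set: W] f,
      forall w, (0 <= f w)%E &
      exists N, [/\ measurable N, P N = 0%E &
        forall A, measurable A ->
          (Q A = \int[P]_(w in A) f w + Q (A `&` N))%E]].

Lemma likelihood_ratio_dominated {R : realType} {dW : measure_display}
    {W : measurableType dW} (P Q : probability W R) (f : W -> \bar R) :
  Q `<< P -> measurable_fun [set: W] f -> (forall w, 0 <= f w)%E ->
  likelihood_ratio P Q f <->
  forall A, measurable A -> (Q A = \int[P]_(w in A) f w)%E.
Proof.
move=> QP mf f0; split=> [[_ _ [N [mN PN0 QE]]] A mA|QE].
  rewrite QE// [X in (_ + X)%E](_ : _ = 0%E) ?adde0//.
  have QN0 : Q N = 0%E.
    exact: ((null_content_dominatesP Q P).1 QP N mN PN0).
  by apply/eqP; rewrite -measure_le0 -QN0 le_measure ?inE//; exact: measurableI.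
split=> //; exists set0; split=> // A mA.
by rewrite setI0 measure0 adde0 QE.
Qed.


Definition symmetric_posdef {R : realType} (d : nat) (S : 'M[R]_d) : Prop :=
  S^T = S /\ forall u : 'cV[R]_d, u != 0 -> 0 < quadform S u.

(* The remainder eps_T of the expansion takes the value -oo where the likelihood
   ratio vanishes ([lne 0 = -oo]). *)
Definition LAN {R : realType} (d : nat) (time : set R) {dE : measure_display}
    {E : measurableType dE} (PT : 'cV[R]_d -> forall T, probability (trajectory time E T) R)
    (Theta : set 'cV[R]_d) (c : R -> R) (I : 'M[R]_d) (theta : 'cV[R]_d) : Prop :=
  [/\ symmetric_posdef I,
      c T @[T --> at_infty time] --> 0,
      \forall T \near at_infty time, 0 < c T &
      exists Delta : forall T, {mfun trajectory time E T >-> borel_cV R d},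
        (exists2 N, centered_gaussian I N &
           cvg_in_distribution (at_infty time) (PT theta) (fun T => Delta T) N) /\
        forall u : 'cV[R]_d,
          (\forall T \near at_infty time, Theta (theta + c T *: u)) /\
          exists Lambda : forall T, trajectory time E T -> \bar R,
            (\forall T \near at_infty time,
               likelihood_ratio (PT theta T) (PT (theta + c T *: u) T) (Lambda T)) /\
            let eps T w := (lne (Lambda T w) -
              (dotv u (Delta T w) - quadform I u / 2)%:E)%E in
            forall delta : R, 0 < delta ->
              PT theta T [set w | (delta%:E < `|eps T w|)%E]
                @[T --> at_infty time] --> 0%E].

Definition regular_at {R : realType} (d k : nat) (time : set R) {dE : measure_display}
    {E : measurableType dE} (PT : 'cV[R]_d -> forall T, probability (trajectory time E T) R)
    (g : 'cV[R]_d -> 'cV[R]_k) (ghat : forall T, trajectory time E T -> 'cV[R]_k)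
    (theta : 'cV[R]_d) : Prop :=
  exists2 L, centered_finite_variance L &
    forall u : 'cV[R]_d,
      let theta_ T := theta + (Num.sqrt T)^-1 *: u in
      cvg_in_distribution (at_infty time) (fun T => PT (theta_ T) T)
        (fun T w => Num.sqrt T *: (ghat T w - g (theta_ T))) L.

(* m is a version of E(Y | X = .), componentwise. *)
Definition is_regression {R : realType} (k : nat) {dE dO : measure_display}
    {E : measurableType dE} {Omega : measurableType dO} (P : probability Omega R)
    (X : {mfun Omega >-> E}) (Y : {mfun Omega >-> borel_cV R k})
    (m : E -> 'cV[R]_k) : Prop :=
  forall i : 'I_k,
    [/\ P.-integrable [set: Omega] (fun w => ((Y w : 'cV[R]_k) i ord0)%:E),
        measurable_fun [set: E] (fun x => m x i 0) &
        forall B, measurable B ->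
          (\int[P]_(w in X @^-1` B) ((Y w : 'cV[R]_k) i ord0)%:E =
           \int[P]_(w in X @^-1` B) (m (X w) i ord0)%:E)%E].

(* Measurability of (x, theta) |-> g x theta on E x Theta for the trace of the
   product sigma-algebra; Theta is not required to be a Borel set. *)
Definition measurable_on_Theta {R : realType} (d k : nat) {dE : measure_display}
    {E : measurableType dE} (Theta : set 'cV[R]_d) (g : E -> 'cV[R]_d -> 'cV[R]_k)
    : Prop :=
  forall A : set (borel_cV R k), measurable A ->
    exists2 B : set (E * borel_cV R d), measurable B &
      forall x theta, Theta theta -> (A (g x theta) <-> B (x, theta)).

(* Frechet differentiability at theta relative to D, with k x d Jacobian J; at an
   interior point of D this is the usual notion. *)
Definition is_jacobian_within {R : realType} (d k : nat) (D : set 'cV[R]_d)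
    (g : 'cV[R]_d -> 'cV[R]_k) (theta : 'cV[R]_d) (J : 'M[R]_(k, d)) : Prop :=
  forall e : R, 0 < e -> \forall h \near (0 : 'cV[R]_d),
    D (theta + h) -> `|g (theta + h) - g theta - J *m h| <= e * `|h|.

Lemma quadformE {R : realType} (k : nat) (S : 'M[R]_k) (y : 'cV[R]_k) :
  quadform S y = \sum_i \sum_j (y i 0 * y j 0) * S i j.
Proof.
rewrite /quadform mxE exchange_big /=; apply: eq_bigr => j _.
rewrite mxE big_distrl /=; apply: eq_bigr => i _.
by rewrite mxE mulrAC.
Qed.

Lemma integral_quadform {R : realType} (k : nat) {d : measure_display}
    {T : measurableType d} (nu : {measure set T -> \bar R}) (S : T -> 'M[R]_k)
    (y : 'cV[R]_k) :
  (forall i j, nu.-integrable [set: T] (fun x => (S x i j)%:E)) ->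
  (\int[nu]_x (quadform (S x) y)%:E)%E =
  (quadform (\matrix_(i, j) \int[nu]_x S x i j) y)%:E.
Proof.
move=> iS.
have iZ i j : nu.-integrable [set: T] (fun x => ((y i 0 * y j 0) * S x i j)%:E).
  under eq_fun do rewrite EFinM; exact: integrableZl.
under eq_integral do rewrite quadformE -sumEFin.
rewrite integral_sum//; last first.
  move=> i; under eq_fun do rewrite -sumEFin; exact: integrable_sum.
rewrite quadformE -sumEFin; apply: eq_bigr => i _.
under eq_integral do rewrite -sumEFin.
rewrite integral_sum// -sumEFin; apply: eq_bigr => j _.
under eq_integral do rewrite EFinM.
rewrite integralZl// [RHS]EFinM mxE; congr (_ * _)%E.
by rewrite /Rintegral fineK// integrable_fin_num.
Qed.

Section qer.
Context {R : realType} (k : nat) {dE dW : measure_display} {E : measurableType dE}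
  {W : measurableType dW} (mu : {measure set E -> \bar R}) (P : probability W R).
Implicit Types (err : E -> W -> 'cV[R]_k) (y : 'cV[R]_k).

Definition sqmx (v : 'cV[R]_k) : 'M[R]_k := v *m v^T.

Definition qer err : 'M[R]_k :=
  \matrix_(i, j) \int[mu]_x \int[P]_w sqmx (err x w) i j.

(* The diagonal entries control the others, since 2|ab| <= a^2 + b^2. *)
Definition qer_finite err : Prop := forall i : 'I_k,
  (\int[mu]_x \int[P]_w (sqmx (err x w) i i)%:E < +oo)%E.

(* y' rho y with values in [0, +oo].  Nothing guarantees that all the entries of
   rho exist; when they do not, the integral of the (nonnegative) quadratic form is
   taken.  Both expressions agree when the entries exist, see [qer_formE]. *)
Definition qer_form err y : \bar R :=
  if `[< qer_finite err >] then (quadform (qer err) y)%:E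
  else (\int[mu]_x \int[P]_w (quadform (sqmx (err x w)) y)%:E)%E.

Lemma qer_formE (err : E -> W -> 'cV[R]_k) (y : 'cV[R]_k) :
  (forall i, measurable_fun [set: E * W] (fun p => err p.1 p.2 i 0)) ->
  qer_form err y =
  (\int[mu]_x \int[P]_w (quadform (sqmx (err x w)) y)%:E)%E.
Proof.
move=> merr; rewrite /qer_form; case: asboolP => // fin.
pose M x : 'M[R]_k := \matrix_(i, j) \int[P]_w sqmx (err x w) i j.
have sqE v i j : sqmx v i j = v i 0 * v j 0.
  by rewrite /sqmx mxE big_ord1 !mxE.
have msq i j : measurable_fun [set: E * W] (fun p => sqmx (err p.1 p.2) i j).
  under eq_fun do rewrite sqE; exact: measurable_funM.
have msq1 i j x : measurable_fun [set: W] (fun w => sqmx (err x w) i j).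
  exact: (measurableT_comp (msq i j) (measurable_pair1 x)).
have sq_ge0 i x w : 0 <= sqmx (err x w) i i.
  by rewrite sqE -expr2 sqr_ge0.
pose V i x := (\int[P]_w (sqmx (err x w) i i)%:E)%E.
have V0 i x : (0 <= V i x)%E.
  by apply: integral_ge0 => w _; rewrite lee_fin.
have mV i : measurable_fun [set: E] (V i).
  apply: (@measurable_fun_fubini_tonelli_F _ _ _ _ _ P
    (fun p => (sqmx (err p.1 p.2) i i)%:E)).
    exact/measurable_EFinP.
  by move=> p; rewrite lee_fin.
have iV i : mu.-integrable [set: E] (V i).
  apply/integrableP; split=> //; under eq_integral do rewrite gee0_abs//.
  exact: fin.
have bound i j x w :
    `|sqmx (err x w) i j| <= sqmx (err x w) i i + sqmx (err x w) j j.
  rewrite !sqE; set a := err x w i 0; set b := err x w j 0.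
  have := sqr_ge0 (a + b); have := sqr_ge0 (a - b).
  rewrite ler_norml !expr2; have := sqr_ge0 a; have := sqr_ge0 b.
  rewrite !expr2 => *; apply/andP; split; nra.
have aeV : {ae mu, forall x, forall i, V i x < +oo}%E.
  apply: filter_forall => i.
  have := integrable_ae measurableT (iV i); apply: filterS => x /(_ I).
  by rewrite fin_num_abs gee0_abs.
have ipt x : (forall i, V i x < +oo)%E -> forall i j,
    P.-integrable [set: W] (fun w => (sqmx (err x w) i j)%:E).
  move=> Vx i j; apply: (@le_integrable _ _ _ _ _ _ _
    (fun w => (sqmx (err x w) i i)%:E + (sqmx (err x w) j j)%:E)%E) => //.
  - exact/measurable_EFinP.
  - move=> w _; rewrite /= lee_fin (le_trans (bound _ _ _ _))// ler_norm//.
  - apply: integrableD => //; apply/integrableP; split; try exact/measurable_EFinP.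
    + by under eq_integral do rewrite gee0_abs ?lee_fin//; exact: Vx.
    + by under eq_integral do rewrite gee0_abs ?lee_fin//; exact: Vx.
have mM i j : measurable_fun [set: E] (fun x => M x i j).
  under eq_fun do rewrite mxE /Rintegral.
  apply: (measurableT_comp (fine_measurable measurableT)).
  under eq_fun do rewrite integralE.
  pose f (p : E * W) := (sqmx (err p.1 p.2) i j)%:E.
  have mf : measurable_fun [set: E * W] f by exact/measurable_EFinP.
  apply: emeasurable_funB.
  - have fp0 p : (0 <= f^\+ p)%E by exact: funepos_ge0.
    have := measurable_fun_fubini_tonelli_F (m2 := P) f^\+%E (measurable_funepos mf) fp0.
    congr measurable_fun; apply/funext => x; apply: eq_integral => w _.
    by rewrite !funeposE.
  - have fn0 p : (0 <= f^\- p)%E by exact: funeneg_ge0.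
    have := measurable_fun_fubini_tonelli_F (m2 := P) f^\-%E (measurable_funeneg mf) fn0.
    congr measurable_fun; apply/funext => x; apply: eq_integral => w _.
    by rewrite !funenegE.
have iM i j : mu.-integrable [set: E] (fun x => (M x i j)%:E).
  apply/integrableP; split; first exact/measurable_EFinP.
  apply: (@le_lt_trans _ _ (\int[mu]_x (V i x + V j x))%E); last first.
    by rewrite ge0_integralD//; apply: lte_add_pinfty; exact: fin.
  apply: ae_ge0_le_integral => //.
  - by apply: measurableT_comp => //; exact/measurable_EFinP.
  - by move=> x _; rewrite adde_ge0.
  - exact: emeasurable_funD.
  - apply: filterS aeV => x Vx _; rewrite mxE /Rintegral fineK; last first.
      by apply: integrable_fin_num => //; exact: ipt.
    apply: le_trans (le_abse_integral _ _ _) _ => //; first exact/measurable_EFinP.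
    rewrite -ge0_integralD//; try by [move=> *; rewrite lee_fin|exact/measurable_EFinP].
    apply: ge0_le_integral => //.
    + by apply: measurableT_comp => //; exact/measurable_EFinP.
    + by apply: emeasurable_funD; exact/measurable_EFinP.
    + by move=> w _; rewrite -EFinD lee_fin.
have qerM : qer err = \matrix_(i, j) \int[mu]_x M x i j.
  by apply/matrixP => i j; rewrite !mxE; apply: eq_Rintegral => x _; rewrite mxE.
rewrite qerM -integral_quadform//; apply: ae_eq_integral => //.
- apply/measurable_EFinP; under eq_fun do rewrite quadformE.
  by apply: measurable_sum => i; apply: measurable_sum => j; exact: measurable_funM.
- apply: (@measurable_fun_fubini_tonelli_F _ _ _ _ _ P
    (fun p => (quadform (sqmx (err p.1 p.2)) y)%:E)).
    apply/measurable_EFinP; under eq_fun do rewrite quadformE.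
    by apply: measurable_sum => i; apply: measurable_sum => j; exact: measurable_funM.
  move=> p; rewrite lee_fin quadformE.
  rewrite [X in 0 <= X](_ : _ = (\sum_i y i 0 * err p.1 p.2 i 0) ^+ 2) ?sqr_ge0//.
  rewrite expr2 big_distrl /=; apply: eq_bigr => i _.
  by rewrite big_distrr /=; apply: eq_bigr => j _; rewrite sqE mulrACA.
- by apply: filterS aeV => x Vx _; rewrite integral_quadform//; exact: ipt.
Qed.

End qer.

(* Main.v *)
(* Fix x and let L be the limit law of sqrt T (rhat_T(x) - r(x, theta)).  Regularity says
   that under theta + t u / sqrt T the limit of this error is L translated by t J u, whereas
   LAN says that the likelihood ratio is asymptotically exp(t u'Delta - t^2 u'I u / 2).
   Testing the change of measure on truncations of y'error and of the likelihood ratio gives,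
   after all truncations are removed, an inequality of Chapman-Robbins type which only
   involves the marginal limits of the error and of Delta (no joint limit is needed):
     t y'J u <= (t / 2) E_L (y'z)^2 + (exp (t^2 u'I u) - 1) / (2 t).
   For u = I^-1 J'y and t -> 0 it reads y'J I^-1 J'y <= E_L (y'z)^2.  Weak convergence bounds
   liminf T E (y'(rhat_T(x) - r(x, theta)))^2 from below by E_L (y'z)^2, and Fatou's lemma
   along a sequence that realizes the liminf integrates the bound over x. *)
Require Import Defs.
From HB Require Import structures.
From mathcomp Require Import all_boot all_order all_algebra.
From mathcomp Require Import all_classical all_reals all_analysis measurable_realfun.
From mathcomp Require Import ring lra.
Import Order.TTheory GRing.Theory Num.Theory.
Import numFieldNormedType.Exports.

Set Implicit Arguments.
Unset Strict Implicit.
Unset Printing Implicit Defensive.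

Local Open Scope classical_set_scope.
Local Open Scope ring_scope.

(** * Change of measure through a likelihood ratio *)

(** The density [p] and the Radon-Nikodym derivative have the same integral over every measurable
    set, hence agree [m]-almost everywhere, and the change of variables formula passes to [p]. *)
Lemma ge0_integral_density {dT : measure_display} {T : measurableType dT} {R : realType}
    (m : {sigma_finite_measure set T -> \bar R})
    (nu : {finite_measure set T -> \bar R}) (p g : T -> \bar R) :
  measurable_fun [set: T] p ->
  (forall A, measurable A -> nu A = \int[m]_(x in A) p x)%E ->
  measurable_fun [set: T] g -> (forall x, 0 <= g x)%E ->
  (\int[nu]_x g x = \int[m]_x (g x * p x))%E.
Proof.
move=> mp nuE mg g0.
have num : nu `<< m.
  apply/null_content_dominatesP => A mA mA0.
  by rewrite nuE// null_set_integral//; exact: measurable_funTS.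
have irn := Radon_Nikodym_SigmaFinite.f_integrable num.
rewrite -(Radon_Nikodym_SigmaFinite.change_of_variables num)//.
apply: ae_eq_integral => //.
- by apply: emeasurable_funM => //; exact: measurable_int irn.
- exact: emeasurable_funM.
- apply: ae_eqe_mul2l; apply: integral_ae_eq => // A _ mA.
  by rewrite -Radon_Nikodym_SigmaFinite.f_integral// nuE.
Qed.

(** Off the [P]-null set [N] that carries the singular part, [Q] has density [f] with respect to
    [P]; the mass of [Q] on [N] can only increase the right side. *)
Lemma le_integral_likelihood_ratio {dW : measure_display} {W : measurableType dW}
    {R : realType} (P Q : probability W R) (f g : W -> \bar R) :
  likelihood_ratio P Q f ->
  measurable_fun [set: W] g -> (forall w, 0 <= g w)%E ->
  (\int[P]_w (g w * f w) <= \int[Q]_w g w)%E.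
Proof.
move=> [mf f0 [N [mN PN0 QE]]] mg g0.
have mCN := measurableC mN.
pose nu : {finite_measure set W -> \bar R} := mrestr Q mCN.
have nuE A : measurable A -> nu A = (\int[P]_(w in A) f w)%E.
  move=> mA; rewrite /nu/= /mrestr QE; last exact: measurableI.
  rewrite [X in Q X](_ : _ = set0); last by apply/seteqP; split=> // w /= -[[_]].
  rewrite measure0 adde0 -setDE.
  apply/esym.
  have mfA D : measurable_fun D f by exact: measurable_funTS.
  rewrite -[in LHS](setDUK (@subIsetl _ A N)) setDIr setDv set0U ge0_integral_setU//=.
  - rewrite (@null_set_integral _ _ _ _ (A `&` N))// ?add0e//.
    + exact: measurableI.
    + by apply/eqP; rewrite -measure_le0 -PN0 le_measure ?inE//; exact: measurableI.
  - exact: measurableI.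
  - exact: measurableD.
  - by apply/disj_setPS => w /= [[_ ?] []].
rewrite -(ge0_integral_density mf nuE)//.
apply: (@le_trans _ _ (\int[mrestr Q mCN]_w g w + \int[mrestr Q mN]_w g w)%E).
  by rewrite leeDl// integral_ge0.
rewrite -ge0_integral_measure_add//=.
rewrite le_eqVlt; apply/orP; left; apply/eqP/eq_measure_integral => A mA _.
etransitivity; first exact: measure_addE.
rewrite /= /mrestr -measureU//.
- by rewrite -setIUr setUC setUv setIT.
- exact: measurableI.
- exact: measurableI.
- by apply/seteqP; split => // w [[_ ?] []].
Qed.

Lemma bounded_integrable {dW : measure_display} {W : measurableType dW} {R : realType}
    (P : probability W R) (f : W -> R) (B : R) :
  measurable_fun [set: W] f -> (forall w, `|f w| <= B) ->
  P.-integrable [set: W] (EFin \o f).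
Proof.
move=> mf fB; apply: measurable_bounded_integrable => //.
  by apply: (@le_lt_trans _ _ 1%E); rewrite ?probability_le1// ltry.
by exists B; split => [|x Bx w _]; [exact: num_real|exact: le_trans (fB w) (ltW Bx)].
Qed.

Lemma Rintegral_cst_probability {dW : measure_display} {W : measurableType dW}
    {R : realType} (P : probability W R) (r : R) : \int[P]_w r = r.
Proof.
by rewrite Rintegral_cst// [X in fine X](probability_setT P) mulr1.
Qed.

Lemma measurable_lne {R : realType} : measurable_fun [set: \bar R] (@lne R).
Proof.
apply: (measurability _ (ErealGenOInfty.measurableE R)) => //.
move=> _ [_ [r ->] <-]; rewrite setTI.
rewrite (_ : _ @^-1` _ = `](expR r)%:E, +oo[%classic).
  exact: emeasurable_itv.
apply/seteqP; split => x /=; rewrite !in_itv/= !andbT.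
- have [x0|x0] := leP x 0%E; first by rewrite le0_lneNy.
  rewrite -{1}(expeRK r%:E) lte_lne// in_itv/= leey ?andbT ?(ltW x0)//.
- move=> rx; have x0 : (0 < x)%E by apply: lt_trans rx; rewrite lte_fin expR_gt0.
  rewrite -{1}(expeRK r%:E) lte_lne// in_itv/= leey ?andbT ?(ltW x0)//.
Qed.

(** The inequality for nonnegative functions, applied to [B - f], becomes an upper bound for the
    integral of [f]. The second term pays for the mass lost by truncating at [M], the last one for
    replacing the log-likelihood by [l], up to [delta] off the set where they differ by more. *)
Lemma le_Rintegral_likelihood_ratio {dW : measure_display} {W : measurableType dW}
    {R : realType} (P Q : probability W R) (Lambda : W -> \bar R) (l f : W -> R)
    (M B delta : R) :
  likelihood_ratio P Q Lambda ->
  measurable_fun [set: W] l -> measurable_fun [set: W] f ->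
  0 <= M -> 0 <= delta -> (forall w, `|f w| <= B) ->
  \int[Q]_w f w <= \int[P]_w (f w * Num.min (expR (l w)) M)
    + B * (1 - \int[P]_w Num.min (expR (l w)) M)
    + B * M *+ 2 *
      (delta + fine (P [set w | (delta%:E < `|lne (Lambda w) - (l w)%:E|)%E])).
Proof.
move=> LR ml mf M0 delta0 fB; have [mL L0 _] := LR.
set bad := [set w | _]; pose h w := Num.min (expR (l w)) M.
have mbad : measurable bad.
  rewrite /bad -[X in measurable X]setTI.
  apply: emeasurable_fun_o_infty => //; apply: measurableT_comp => //.
  apply: emeasurable_funB; first exact: measurableT_comp measurable_lne _.
  exact/measurable_EFinP.
have mh : measurable_fun [set: W] h.
  apply: measurable_minr => //.
  exact: measurableT_comp.
have h0 w : 0 <= h w by rewrite le_min expR_ge0.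
have hM w : h w <= M by rewrite ge_min lexx orbT.
have ih : P.-integrable [set: W] (EFin \o h).
  by apply: (@bounded_integrable _ _ _ _ _ M) => // w; rewrite ger0_norm.
have B0 : 0 <= B by apply: le_trans (fB point).
pose g w := B - f w.
have mg : measurable_fun [set: W] g by apply: measurable_funB.
have g0 w : 0 <= g w by rewrite subr_ge0 (le_trans (ler_norm _)).
have g2B w : g w <= B *+ 2.
  by have := fB w; rewrite ler_norml /g => /andP[? _]; rewrite mulr2n; lra.
pose c w := h w - M * (delta + \1_bad w).
have mi : measurable_fun [set: W] (\1_bad : W -> R) by exact: measurable_indic.
have mc : measurable_fun [set: W] c.
  apply: measurable_funB => //; apply: measurable_funM => //.
  exact: measurable_funD.
have i01 w : 0 <= (\1_bad w : R) <= 1 by rewrite indicE; case: (w \in bad); rewrite ?lexx ler01.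
(* Off [bad], [Lambda >= expR (- delta) * h >= h - M * delta]; on [bad], [c <= 0]. *)
have cL w : ((c w)%:E <= Lambda w)%E.
  rewrite /c indicE; have [/set_mem wb|/negP wb] := boolP (w \in bad).
    apply: le_trans (L0 w); rewrite lee_fin.
    have := hM w; have := mulr_ge0 M0 delta0; rewrite /=; lra.
  have {wb} : (`|lne (Lambda w) - (l w)%:E| <= delta%:E)%E.
    by rewrite leNgt; apply/negP => ?; apply: wb; rewrite inE.
  have := L0 w; case: (Lambda w) => [v| |] //=; rewrite ?leey//.
  (* A zero of [Lambda] lies in [bad]: there [lne] is -oo, at infinite distance from [l]. *)
  case: ifPn => [v0|]; first by rewrite leye_eq.
  rewrite -ltNge => v0 _; rewrite !lee_fin ler_norml => /andP[lv _].
  have : expR (l w) * expR (- delta) <= v.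
    rewrite -expRD -[leRHS]lnK ?posrE// ler_expR; lra.
  apply: le_trans; rewrite addr0.
  have : h w * expR (- delta) <= expR (l w) * expR (- delta).
    by rewrite ler_wpM2r ?expR_ge0// ge_min lexx.
  apply: le_trans.
  have : h w * (1 - delta) <= h w * expR (- delta).
    by rewrite ler_wpM2l// expR_ge1Dx.
  apply: le_trans.
  have := ler_wpM2r delta0 (hM w); rewrite mulrBr mulr1; lra.
have igc : P.-integrable [set: W] (fun w => (g w * c w)%:E).
  apply: (@bounded_integrable _ _ _ _ _ (B *+ 2 * (M + M * (delta + 1)))).
    exact: measurable_funM.
  move=> w; rewrite normrM ler_pM ?(ger0_norm (g0 w))//.
  have /andP[i0 i1] := i01 w.
  rewrite /c (le_trans (ler_normB _ _))// lerD//; first by rewrite ger0_norm.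
  by rewrite ger0_norm ?mulr_ge0 ?addr_ge0// ler_wpM2l// lerD2l.
have intQf : Q.-integrable [set: W] (EFin \o f) by exact: bounded_integrable fB.
have intQg : Q.-integrable [set: W] (EFin \o g).
  by apply: (@bounded_integrable _ _ _ _ _ (B *+ 2)) => // w; rewrite ger0_norm.
have gle : (\int[P]_w (g w * c w)%:E <= \int[Q]_w (g w)%:E)%E.
  have gL : (\int[P]_w ((g w)%:E * Lambda w) <= \int[Q]_w (g w)%:E)%E.
    apply: le_integral_likelihood_ratio => //; exact/measurable_EFinP.
  apply: le_trans (gL); apply: le_integral => //.
    apply/integrableP; split.
      by apply: emeasurable_funM => //; exact/measurable_EFinP.
    under eq_integral do rewrite gee0_abs ?mule_ge0 ?lee_fin//.
    apply: le_lt_trans gL _.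
    have := integrable_lty measurableT intQg; apply: le_lt_trans.
    by [].
  by move=> w _; rewrite EFinM lee_wpmul2l ?lee_fin.
have {}gle : \int[P]_w (g w * c w) <= \int[Q]_w g w.
  by apply: fine_le => //; exact: integrable_fin_num.
have gQ : \int[Q]_w g w = B - \int[Q]_w f w.
  rewrite /g RintegralB// ?Rintegral_cst_probability//.
  exact: finite_measure_integrable_cst.
(* A lower bound of [g * c] with an explicit integral, obtained from [g <= B *+ 2]. *)
pose k w := (B * h w - f w * h w) - B *+ 2 * M * (delta + \1_bad w).
have ifh : P.-integrable [set: W] (fun w => (f w * h w)%:E).
  apply: (@bounded_integrable _ _ _ _ _ (B * M)); first exact: measurable_funM.
  by move=> w; rewrite normrM ler_pM// ger0_norm.
have iBh : P.-integrable [set: W] (fun w => (B * h w)%:E).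
  by under eq_fun do rewrite EFinM; exact: integrableZl.
have i1 : P.-integrable [set: W] (EFin \o (\1_bad : W -> R)).
  exact: integrable_indic.
have idelta : P.-integrable [set: W] (EFin \o cst delta).
  exact: finite_measure_integrable_cst.
have idi : P.-integrable [set: W] (EFin \o (fun w => delta + \1_bad w)).
  exact: (integrableD measurableT idelta i1).
have ik2 : P.-integrable [set: W] (fun w => (B *+ 2 * M * (delta + \1_bad w))%:E).
  by under eq_fun do rewrite EFinM; exact: (integrableZl measurableT _ idi).
have ik1 : P.-integrable [set: W] (EFin \o (fun w => B * h w - f w * h w)).
  exact: (integrableB measurableT iBh ifh).
have ik : P.-integrable [set: W] (EFin \o k).
  exact: (integrableB measurableT ik1 ik2).
have : \int[P]_w k w <= \int[P]_w (g w * c w).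
  apply: le_Rintegral => // w _; rewrite /k /c /g.
  have /andP[? ?] := i01 w.
  have : (B - f w) * (M * (delta + \1_bad w)) <= B *+ 2 * (M * (delta + \1_bad w)).
    by rewrite ler_wpM2r// ?mulr_ge0// ?addr_ge0//; exact: g2B.
  rewrite mulrA; lra.
rewrite /k RintegralB// RintegralB// RintegralZl// RintegralZl// RintegralD//.
rewrite Rintegral_cst_probability.
have -> : \int[P]_w (\1_bad w : R) = fine (P bad).
  by rewrite /Rintegral integral_indic// setIT.
move: gle; rewrite gQ -/h; lra.
Qed.

(** * Linear and quadratic forms on column vectors *)

Lemma measurable_continuous_borel_cV {R : realType} (k : nat) (f : 'cV[R]_k -> R) :
  continuous f -> measurable_fun [set: borel_cV R k] f.
Proof.
move=> cf; apply: (measurability _ (RGenOpens.measurableE R)) => //.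
move=> _ [_ [a [b ->]] <-]; rewrite setTI; apply: sub_sigma_algebra.
by apply: open_comp => [x _|]; [exact: cf|exact: interval_open].
Qed.

Lemma dotvE {R : realType} (k : nat) (y z : 'cV[R]_k) :
  dotv y z = \sum_i y i 0 * z i 0.
Proof. by rewrite /dotv mxE; apply: eq_bigr => i _; rewrite mxE. Qed.

Lemma dotvZl {R : realType} (k : nat) (a : R) (y z : 'cV[R]_k) :
  dotv (a *: y) z = a * dotv y z.
Proof. by rewrite /dotv linearZ -scalemxAl mxE. Qed.

Lemma quadformZ {R : realType} (k : nat) (S : 'M[R]_k) (a : R) (u : 'cV[R]_k) :
  quadform S (a *: u) = a ^+ 2 * quadform S u.
Proof.
by rewrite /quadform -scalemxAr [(a *: u)^T]linearZ /= -!scalemxAl scalerA mxE.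
Qed.

Lemma continuous_dotv {R : realType} (k : nat) (y : 'cV[R]_k) : continuous (dotv y).
Proof.
rewrite (_ : dotv y = fun z => \sum_i y i 0 * z i 0); last first.
  by apply/funext => z; rewrite dotvE.
apply: continuous_big => [x|i _ z]; first exact: add_continuous.
apply: (@continuousM _ _ (fun=> y i 0) (fun z : 'cV[R]_k => z i 0)).
  exact: cst_continuous.
exact: coord_continuous.
Qed.

(** * The Gaussian limit of the likelihood ratio and its truncation *)

(** Completing the square: the exponential weight moves the mean from 0 to the variance. *)
Lemma normal_pdf_shift {R : realType} (s x : R) : s != 0 ->
  expR (x - s ^+ 2 / 2) * normal_pdf 0 s x = normal_pdf (s ^+ 2) s x.
Proof.
move=> s0; rewrite !normal_pdfE// mulrCA; congr (_ * _).
rewrite /normal_fun -expRD; congr expR; field.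
by rewrite s0.
Qed.

(** Only the law N(0, q) of u'z enters, with q = u'Su. The integrand is the density of N(q, q) with
    respect to N(0, q), so its integral is 1: no mass is lost in the limit. *)
Lemma gaussian_mgf {R : realType} (d : nat) (S : 'M[R]_d)
    (N : probability (borel_cV R d) R) (u : 'cV[R]_d) :
  centered_gaussian S N -> u != 0 -> 0 < quadform S u ->
  (\int[N]_z (expR (dotv u z - quadform S u / 2))%:E = 1)%E.
Proof.
move=> GN u0 q0; set q := quadform S u; pose s := Num.sqrt q.
have s0 : s != 0 by rewrite gt_eqF// sqrtr_gt0.
have sq : s ^+ 2 = q by rewrite sqr_sqrtr// ltW.
have md : measurable_fun [set: borel_cV R d] (dotv u : _ -> measurableTypeR R).
  by apply: measurable_continuous_borel_cV; exact: continuous_dotv.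
pose md_mixin := isMeasurableFun.Build _ _ _ _ _ md.
pose D : {mfun borel_cV R d >-> measurableTypeR R} := HB.pack (dotv u) md_mixin.
pose f x : \bar R := (expR (x - q / 2))%:E.
have mf : measurable_fun [set: R] f.
  apply/measurable_EFinP; apply: measurableT_comp => //.
  exact: measurable_funB.
have f0 x : (0 <= f x)%E by rewrite lee_fin expR_ge0.
transitivity (\int[distribution N D]_x f x)%E.
  by rewrite ge0_integral_distribution.
transitivity (\int[normal_prob 0 s]_x f x)%E.
  by apply: eq_measure_integral => A mA _; exact: GN.
rewrite (@ge0_integral_density _ _ _ lebesgue_measure (normal_prob 0 s)
  (EFin \o normal_pdf 0 s))//; last first.
  by apply/measurable_EFinP; exact: measurable_normal_pdf.
rewrite -(integral_normal_pdf q s); apply: eq_integral => x _.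
by rewrite /f /= -EFinM -sq normal_pdf_shift.
Qed.

(* The truncation at M makes the limiting likelihood ratio a bounded continuous function,
   to which weak convergence applies. *)
Definition truncated_lr {R : realType} (d : nat) (S : 'M[R]_d) (u : 'cV[R]_d) (M : R)
    (z : 'cV[R]_d) : R :=
  Num.min (expR (dotv u z - quadform S u / 2)) M.

Lemma continuous_expR_dotv {R : realType} (d : nat) (u : 'cV[R]_d) (b : R) :
  continuous (fun z => expR (dotv u z - b)).
Proof.
move=> z; apply: (@continuous_comp _ _ _ (fun z => dotv u z - b) (@expR R));
  last exact: continuous_expR.
apply: (@continuousB _ _ _ (dotv u) (fun=> b)); last exact: cst_continuous.
exact: continuous_dotv.
Qed.

Lemma truncated_lr_ge0 {R : realType} (d : nat) (S : 'M[R]_d) (u : 'cV[R]_d) (M : R) z :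
  0 <= M -> 0 <= truncated_lr S u M z.
Proof. by move=> M0; rewrite le_min expR_ge0. Qed.

Lemma truncated_lr_le {R : realType} (d : nat) (S : 'M[R]_d) (u : 'cV[R]_d) (M : R) z :
  truncated_lr S u M z <= M.
Proof. by rewrite ge_min lexx orbT. Qed.

Lemma continuous_truncated_lr {R : realType} (d : nat) (S : 'M[R]_d) (u : 'cV[R]_d)
    (M : R) : continuous (truncated_lr S u M).
Proof.
move=> z; apply: (@continuous_min _ _ (fun z => expR (dotv u z - quadform S u / 2))
  (fun=> M)); last exact: cst_continuous.
exact: continuous_expR_dotv.
Qed.

(** Dominated convergence under the untruncated ratio, whose integral is 1. *)
Lemma cvg_Rintegral_truncated_lr {R : realType} (d : nat) (S : 'M[R]_d)
    (N : probability (borel_cV R d) R) (u : 'cV[R]_d) :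
  centered_gaussian S N -> u != 0 -> 0 < quadform S u ->
  \int[N]_z truncated_lr S u n%:R z @[n --> \oo] --> (1 : R).
Proof.
move=> GN u0 q0; set l := fun z => expR (dotv u z - quadform S u / 2).
have mgf : (\int[N]_z (l z)%:E = 1)%E.
  exact: gaussian_mgf GN u0 q0.
have ml : measurable_fun [set: borel_cV R d] l.
  apply: measurable_continuous_borel_cV; rewrite /l.
    exact: continuous_expR_dotv.
have mt n : measurable_fun [set: borel_cV R d] (truncated_lr S u n%:R).
  by apply: measurable_continuous_borel_cV; exact: continuous_truncated_lr.
have il : N.-integrable [set: borel_cV R d] (EFin \o l).
  apply/integrableP; split; first exact/measurable_EFinP.
  under eq_integral do rewrite gee0_abs ?lee_fin ?expR_ge0//.
  by rewrite mgf ltry.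
have [||||| _ _] := @dominated_convergence _ _ _ N setT measurableT
  (fun n z => (truncated_lr S u n%:R z)%:E) (EFin \o l) (EFin \o l) => //.
- by move=> n; exact/measurable_EFinP.
- exact/measurable_EFinP.
- apply: aeW => z _; apply: cvg_EFin; first by apply: nearW.
  apply: cvg_near_cst; near=> n; rewrite /= /truncated_lr; apply/min_idPl.
  by near: n; exact: nbhs_infty_ger.
- apply: aeW => z n _; rewrite /= lee_fin ger0_norm; last exact: truncated_lr_ge0.
  by rewrite ge_min lexx.
by rewrite mgf; exact: fine_cvg.
Unshelve. all: by end_near.
Qed.

(** The second moment is at most that of the untruncated ratio, which is exp(q) with q = u'Su: the
    square of the ratio along [u] is exp(q) times the ratio along [2 *: u]. As [M] grows the bound
    tends to exp(q) - 1, the chi-square divergence of the limiting normal laws. *)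
Lemma Rintegral_truncated_lr_sqr_le {R : realType} (d : nat) (S : 'M[R]_d)
    (N : probability (borel_cV R d) R) (u : 'cV[R]_d) (M : R) :
  centered_gaussian S N -> u != 0 -> 0 < quadform S u -> 0 <= M ->
  \int[N]_z (truncated_lr S u M z - 1) ^+ 2 <=
  expR (quadform S u) + 1 - (\int[N]_z truncated_lr S u M z) *+ 2.
Proof.
move=> GN u0 q0 M0; set q := quadform S u; set h := truncated_lr S u M.
have mh : measurable_fun [set: borel_cV R d] h.
  by apply: measurable_continuous_borel_cV; exact: continuous_truncated_lr.
have h0 z : 0 <= h z by exact: truncated_lr_ge0.
have hM z : h z <= M by exact: truncated_lr_le.
have ih : N.-integrable [set: borel_cV R d] (EFin \o h).
  by apply: (@bounded_integrable _ _ _ _ _ M) => // w; rewrite ger0_norm.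
have ih2 : N.-integrable [set: borel_cV R d] (EFin \o (fun z => h z ^+ 2)).
  apply: (@bounded_integrable _ _ _ _ _ (M ^+ 2)); first exact: measurable_funX.
  by move=> w; rewrite normrX lerXn2r ?nnegrE// ger0_norm.
have me : measurable_fun [set: borel_cV R d]
    (fun z => (expR (dotv (2 *: u) z - quadform S (2 *: u) / 2))%:E).
  apply/measurable_EFinP; apply: measurable_continuous_borel_cV.
  exact: continuous_expR_dotv.
have mgf2 : (\int[N]_z (expR (dotv (2 *: u) z - quadform S (2 *: u) / 2))%:E = 1)%E.
  apply: (gaussian_mgf GN); first by rewrite scaler_eq0 negb_or pnatr_eq0.
  by rewrite quadformZ mulr_gt0.
have h2 : \int[N]_z h z ^+ 2 <= expR q.
  rewrite -lee_fin /Rintegral fineK; last exact: integrable_fin_num.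
  rewrite -[leRHS]mule1 -mgf2 -ge0_integralZl//.
  apply: ge0_le_integral => //.
  - by move=> z _; rewrite lee_fin sqr_ge0.
  - exact/measurable_EFinP/measurable_funX.
  - exact: emeasurable_funM.
  move=> z _; rewrite -EFinM lee_fin -expRD.
  apply: (@le_trans _ _ (expR (dotv u z - q / 2) ^+ 2)).
    by rewrite lerXn2r ?nnegrE ?expR_ge0// ge_min lexx.
  by rewrite -expRM_natl ler_expR dotvZl quadformZ -/q expr2; lra.
under eq_Rintegral do rewrite sqrrB1.
have ih22 : N.-integrable [set: borel_cV R d] (EFin \o (fun z => h z *+ 2)).
  apply: (@bounded_integrable _ _ _ _ _ (M *+ 2)).
    by under eq_fun do rewrite mulr2n; exact: measurable_funD.
  by move=> z; rewrite normrMn ger0_norm// lerMn2r hM orbT.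
have ihB : N.-integrable [set: borel_cV R d] (EFin \o (fun z => h z ^+ 2 - h z *+ 2)).
  exact: (integrableB measurableT ih2 ih22).
rewrite RintegralD//; last exact: finite_measure_integrable_cst.
rewrite RintegralB// Rintegral_cst_probability.
have -> : \int[N]_z (h z *+ 2) = (\int[N]_z h z) *+ 2.
  by under eq_Rintegral do rewrite -mulr_natl; rewrite RintegralZl// mulr_natl.
lra.
Qed.

(** * A Chapman-Robbins inequality for limits of bounded statistics *)

(** With h the truncated ratio, the change of measure bounds [b] through the integral of phi h = phi
    + phi (h - 1). The inequality phi (h - 1) <= c phi^2 / 2 + (h - 1)^2 / (2 c) separates [phi]
    from [Delta], so every term has a limit given by a marginal law. *)
Lemma chapman_robbins_limit {R : realType} (d : nat) (F : set_system R) {FF : ProperFilter F}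
    {dW : R -> measure_display} {W : forall t, measurableType (dW t)}
    (P Q : forall t, probability (W t) R)
    (Delta : forall t, {mfun W t >-> borel_cV R d}) (S : 'M[R]_d)
    (N : probability (borel_cV R d) R) (u : 'cV[R]_d)
    (Lambda : forall t, W t -> \bar R) (phi : forall t, W t -> R) (K a1 a2 b M c : R) :
  cvg_in_distribution F P (fun t => Delta t) N ->
  (\forall t \near F, likelihood_ratio (P t) (Q t) (Lambda t)) ->
  (forall delta : R, 0 < delta ->
     P t [set w | (delta%:E < `|lne (Lambda t w) -
       (dotv u (Delta t w) - quadform S u / 2)%:E|)%E] @[t --> F] --> 0%E) ->
  (\forall t \near F, measurable_fun [set: W t] (phi t)) ->
  (forall t w, `|phi t w| <= K) ->
  \int[P t]_w phi t w @[t --> F] --> a1 ->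
  \int[P t]_w phi t w ^+ 2 @[t --> F] --> a2 ->
  \int[Q t]_w phi t w @[t --> F] --> b ->
  0 <= M -> 0 < c ->
  b <= a1 + c / 2 * a2 + (c * 2)^-1 * \int[N]_z (truncated_lr S u M z - 1) ^+ 2
       + K * (1 - \int[N]_z truncated_lr S u M z).
Proof.
move=> DN LR bad mphi phiK cvg1 cvg2 cvgb M0 c0.
set h := truncated_lr S u M.
have ch : continuous h by exact: continuous_truncated_lr.
have ch2 : continuous (fun z => (h z - 1) ^+ 2).
  move=> z; apply: (@continuous_comp _ _ _ h (fun x : R => (x - 1) ^+ 2)); first exact: ch.
  apply: (@continuous_comp _ _ _ (fun x : R => x - 1) (fun x : R => x ^+ 2)).
    apply: continuousB; [exact: id|exact: cst_continuous].
  exact: exprn_continuous.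
have h0 z : 0 <= h z by exact: truncated_lr_ge0.
have hM z : h z <= M by exact: truncated_lr_le.
have hb z : `|h z| <= M by rewrite ger0_norm.
have hb2 z : `|(h z - 1) ^+ 2| <= (M + 1) ^+ 2.
  rewrite normrX lerXn2r ?nnegrE ?addr_ge0//.
  by rewrite (le_trans (ler_normB _ _))// normr1 lerD.
have cvgh : \int[P t]_w h (Delta t w) @[t --> F] --> \int[N]_z h z.
  by apply: DN => //; exists M.
have cvgh2 : \int[P t]_w (h (Delta t w) - 1) ^+ 2 @[t --> F] -->
    \int[N]_z (h z - 1) ^+ 2.
  by apply: (DN (fun z => (h z - 1) ^+ 2)) => //; exists ((M + 1) ^+ 2).
have K0 : 0 <= K by apply: le_trans (phiK 0 point).
have md (g : 'cV[R]_d -> R) : continuous g ->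
    forall t, measurable_fun [set: W t] (fun w => g (Delta t w)).
  move=> cg t; apply: (measurableT_comp (measurable_continuous_borel_cV cg)).
  exact: measurable_funPT.
(* The [0] is the limit, for fixed [delta], of the probability of the exceptional set; [delta] is
   removed at the end. *)
have ineq delta : 0 < delta ->
  b <= (a1 + c / 2 * a2 + (c * 2)^-1 * \int[N]_z (h z - 1) ^+ 2
       + K * (1 - \int[N]_z h z)) + K * M *+ 2 * (delta + 0).
  move=> delta0.
  set B := fun t => fine (P t [set w | (delta%:E < `|lne (Lambda t w) -
       (dotv u (Delta t w) - quadform S u / 2)%:E|)%E]).
  have cvgB : B t @[t --> F] --> (0 : R) by apply: fine_cvg; exact: bad.
  have rhs_cvg : (\int[P t]_w phi t w + c / 2 * \int[P t]_w phi t w ^+ 2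
     + (c * 2)^-1 * \int[P t]_w (h (Delta t w) - 1) ^+ 2
     + K * (1 - \int[P t]_w h (Delta t w))) + K * M *+ 2 * (delta + B t) @[t --> F] -->
     (a1 + c / 2 * a2 + (c * 2)^-1 * \int[N]_z (h z - 1) ^+ 2
       + K * (1 - \int[N]_z h z)) + K * M *+ 2 * (delta + 0).
    have cvgZ (r : R) (f : R -> R) (x : R) : f t @[t --> F] --> x ->
      r * f t @[t --> F] --> r * x by move=> fx; apply: cvgM => //; exact: cvg_cst.
    apply: cvgD; last by apply: cvgZ; apply: cvgD => //; exact: cvg_cst.
    apply: cvgD; last by apply: cvgZ; apply: cvgD; [exact: cvg_cst|exact: cvgN].
    by apply: cvgD; [apply: cvgD => //|]; exact: cvgZ.
  apply: (ler_cvg_to cvgb rhs_cvg); near=> t.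
  have mp : measurable_fun [set: W t] (phi t) by near: t.
  have lr : likelihood_ratio (P t) (Q t) (Lambda t) by near: t.
  have ml : measurable_fun [set: W t] (fun w => dotv u (Delta t w) - quadform S u / 2).
    apply: (md (fun z => dotv u z - quadform S u / 2)) => z.
    apply: (@continuousB _ _ _ (dotv u) (fun=> quadform S u / 2));
      last exact: cst_continuous.
    exact: continuous_dotv.
  have := le_Rintegral_likelihood_ratio lr ml mp M0 (ltW delta0) (phiK t).
  move=> /le_trans; apply; rewrite -/(B t) lerD2r lerD2r.
  have ip : (P t).-integrable [set: W t] (EFin \o phi t).
    exact: bounded_integrable (phiK t).
  have ip2 : (P t).-integrable [set: W t] (EFin \o (fun w => phi t w ^+ 2)).
    apply: (@bounded_integrable _ _ _ _ _ (K ^+ 2)); first exact: measurable_funX.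
    by move=> w; rewrite normrX lerXn2r ?nnegrE.
  have ih2 : (P t).-integrable [set: W t] (EFin \o (fun w => (h (Delta t w) - 1) ^+ 2)).
    by apply: bounded_integrable => [|w]; [exact: (md _ ch2)|exact: hb2].
  rewrite -RintegralZl// -RintegralZl//.
  have ip2' : (P t).-integrable [set: W t] (EFin \o (fun w => c / 2 * phi t w ^+ 2)).
    exact: (integrableZl measurableT (c / 2) ip2).
  have ih2' : (P t).-integrable [set: W t]
      (EFin \o (fun w => (c * 2)^-1 * (h (Delta t w) - 1) ^+ 2)).
    exact: (integrableZl measurableT (c * 2)^-1 ih2).
  have ipp : (P t).-integrable [set: W t]
      (EFin \o (fun w => phi t w + c / 2 * phi t w ^+ 2)).
    exact: (integrableD measurableT ip ip2').
  rewrite -RintegralD// -RintegralD//; apply: le_Rintegral => //.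
  - apply: (@bounded_integrable _ _ _ _ _ (K * M)).
      by apply: measurable_funM => //; exact: (md _ ch).
    by move=> w; rewrite normrM ler_pM// hb.
  - exact: (integrableD measurableT ipp ih2').
  move=> w _; rewrite -/(truncated_lr S u M (Delta t w)) -/(h (Delta t w)).
  set x := phi t w; set y := h (Delta t w).
  (* AM-GM applied to [x (y - 1)] *)
  have : 0 <= (c * 2)^-1 * (c * x - (y - 1)) ^+ 2.
    by rewrite mulr_ge0 ?sqr_ge0// invr_ge0 mulr_ge0// ltW.
  rewrite [X in 0 <= X -> _](_ : _ = c / 2 * x ^+ 2 + (c * 2)^-1 * (y - 1) ^+ 2 - x * (y - 1)).
    by lra.
  by field; rewrite gt_eqF.
(* An excess b - X is refuted by delta = (b - X) / (2 K M + 1), which keeps the error 2 K M delta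
   below b - X; the added 1 makes the divisor positive. *)
rewrite leNgt; apply/negP; set X := (X in X < b) => Xb.
have e0 : 0 < b - X by rewrite subr_gt0.
have KM : 0 < K * M *+ 2 + 1 by rewrite ltr_wpDl// mulrn_wge0// mulr_ge0.
have := ineq _ (divr_gt0 e0 KM); rewrite -/X addr0 -lerBlDl mulrCA leNgt.
by rewrite gtr_pMr// ltr_pdivrMr// mul1r ltrDl ltr01.
Unshelve. all: by end_near.
Qed.

(** * Clipping of unbounded statistics *)

Definition clip {R : realType} (K x : R) : R := Num.max (- K) (Num.min x K).

Lemma clip_le {R : realType} (K x : R) : 0 <= K -> `|clip K x| <= K.
Proof.
move=> K0; rewrite ler_norml /clip le_max lexx/= ge_max ge_min lexx orbT andbT.
lra.
Qed.

Lemma normr_clip_le {R : realType} (K x : R) : 0 <= K -> `|clip K x| <= `|x|.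
Proof.
move=> K0; rewrite ler_norml /clip; case: (leP x K) => xK; case: (leP (- K) _) => Kx;
  have := ler_norm x; have := ler_norm (- x); rewrite normrN; lra.
Qed.

(** Allows a convergent shift inside [clip] to be replaced by its limit, uniformly in the sample
    point. *)
Lemma clip_lipschitz {R : realType} (K x y : R) : 0 <= K ->
  `|clip K x - clip K y| <= `|x - y|.
Proof.
move=> K0; have := ler_norm (x - y); have := ler_norm (- (x - y)); rewrite normrN => ? ?.
rewrite ler_norml /clip !maxEle !minEle; repeat case: ifPn; rewrite -?ltNge;
  move=> *; apply/andP; split; lra.
Qed.

Lemma continuous_clip {R : realType} (K : R) : continuous (@clip R K).
Proof.
move=> x; apply: (@continuous_max _ _ (fun=> - K) (fun x => Num.min x K)).
  exact: cst_continuous.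
by apply: (@continuous_min _ _ (fun x : R => x) (fun=> K)); [exact: cvg_id|exact: cst_continuous].
Qed.

Lemma measurable_clip {R : realType} (K : R) : measurable_fun [set: R] (@clip R K).
Proof. by apply: measurable_maxr => //; exact: measurable_minr. Qed.

(** Dominated convergence under [|f|]; the clip is inactive once [n] reaches [|f w|]. *)
Lemma cvg_Rintegral_clip {dW : measure_display} {W : measurableType dW} {R : realType}
    (P : probability W R) (f : W -> R) :
  P.-integrable [set: W] (EFin \o f) ->
  \int[P]_w clip n%:R (f w) @[n --> \oo] --> \int[P]_w f w.
Proof.
move=> fi; have mf : measurable_fun [set: W] f.
  by apply/measurable_EFinP; exact: measurable_int fi.
have [||||| _ _] := @dominated_convergence _ _ _ P setT measurableT
  (fun n w => (clip n%:R (f w))%:E) (EFin \o f) (EFin \o (fun w => `|f w|)) => //.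
- by move=> n; apply/measurable_EFinP; exact: (measurableT_comp (@measurable_clip _ _)).
- exact/measurable_EFinP.
- apply: aeW => w _; apply: cvg_EFin; first by apply: nearW.
  apply: cvg_near_cst; near=> n; rewrite /= /clip.
  have : `|f w| <= n%:R by near: n; exact: nbhs_infty_ger.
  by rewrite ler_norml => /andP[? ?]; rewrite min_l// max_r.
- exact: integrable_norm.
- by apply: aeW => w n _; rewrite /= lee_fin normr_clip_le.
by move=> dc; apply: fine_cvg; rewrite fineK//; exact: integrable_fin_num.
Unshelve. all: by end_near.
Qed.

Lemma centered_finite_variance_dotv {R : realType} (k : nat)
    (L : probability (borel_cV R k) R) (y : 'cV[R]_k) :
  centered_finite_variance L ->
  [/\ L.-integrable [set: borel_cV R k] (EFin \o dotv y),
      \int[L]_z dotv y z = 0 &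
      L.-integrable [set: borel_cV R k] (EFin \o (fun z => dotv y z ^+ 2))].
Proof.
move=> cL.
have i1 i : L.-integrable [set: borel_cV R k] (fun z : borel_cV R k => ((z : 'cV[R]_k) i 0)%:E).
  apply/Lfun1_integrable; apply: Lfun_subset12; last by have [] := cL i.
  by rewrite fin_num_measure.
have i2 i j : L.-integrable [set: borel_cV R k]
    (fun z : borel_cV R k => ((z : 'cV[R]_k) i 0 * (z : 'cV[R]_k) j 0)%:E).
  apply/Lfun1_integrable; apply: Lfun2_mul_Lfun1; first by have [] := cL i.
  by have [] := cL j.
have i1y i : L.-integrable [set: borel_cV R k]
    (fun z : borel_cV R k => (y i 0 * (z : 'cV[R]_k) i 0)%:E).
  by under eq_fun do rewrite EFinM; exact: integrableZl.
have dE : EFin \o dotv y = (fun z : borel_cV R k => \sum_i (y i 0 * (z : 'cV[R]_k) i 0)%:E)%E.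
  by apply/funext => z; rewrite /= dotvE sumEFin.
split.
- by rewrite dE; apply: integrable_sum => // i _; exact: i1y.
- rewrite /Rintegral -[X in fine (integral _ _ X)]/(EFin \o dotv y) dE integral_sum//.
  rewrite big1// => i _; under eq_integral do rewrite EFinM.
  rewrite integralZl//; have [_] := cL i; rewrite unlock => ->.
  by rewrite mule0.
- rewrite (_ : _ \o _ = (fun z : borel_cV R k =>
      \sum_i \sum_j ((y i 0 * y j 0) * ((z : 'cV[R]_k) i 0 * (z : 'cV[R]_k) j 0))%:E)%E).
    apply: integrable_sum => // i _; apply: integrable_sum => // j _.
    by under eq_fun do rewrite EFinM; exact: integrableZl.
  apply/funext => z; rewrite /= dotvE expr2 big_distrl -sumEFin; apply: eq_bigr => i _.
  rewrite big_distrr /= -sumEFin; apply: eq_bigr => j _.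
  by rewrite mulrACA.
Qed.

(** * The Chapman-Robbins inequality for regular estimators *)

Lemma dotvBr {R : realType} (k : nat) (y a b : 'cV[R]_k) :
  dotv y (a - b) = dotv y a - dotv y b.
Proof. by rewrite /dotv mulmxBr !mxE. Qed.

(** The bounded statistic is y'err clipped at K. Its limit law under [P] comes from [L], under [Q]
    from [L] with y'z translated by [tau]. The truncation of the likelihood ratio is removed first,
    at fixed K, because the mass it loses is multiplied by K; then K tends to infinity. *)
Lemma chapman_robbins_regular {R : realType} (d k : nat) (F : set_system R) {FF : ProperFilter F}
    {dW : R -> measure_display} {W : forall t, measurableType (dW t)}
    (P Q : forall t, probability (W t) R)
    (Delta : forall t, {mfun W t >-> borel_cV R d}) (S : 'M[R]_d)
    (N : probability (borel_cV R d) R) (u : 'cV[R]_d)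
    (Lambda : forall t, W t -> \bar R)
    (err : forall t, W t -> 'cV[R]_k) (shift : R -> 'cV[R]_k)
    (L : probability (borel_cV R k) R) (y : 'cV[R]_k) (tau c : R) :
  centered_gaussian S N -> u != 0 -> 0 < quadform S u ->
  cvg_in_distribution F P (fun t => Delta t) N ->
  (\forall t \near F, likelihood_ratio (P t) (Q t) (Lambda t)) ->
  (forall delta : R, 0 < delta ->
     P t [set w | (delta%:E < `|lne (Lambda t w) -
       (dotv u (Delta t w) - quadform S u / 2)%:E|)%E] @[t --> F] --> 0%E) ->
  (\forall t \near F, measurable_fun [set: W t] (err t : W t -> borel_cV R k)) ->
  centered_finite_variance L ->
  cvg_in_distribution F P err L ->
  cvg_in_distribution F Q (fun t w => err t w - shift t) L ->
  dotv y (shift t) @[t --> F] --> tau ->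
  0 < c ->
  tau <= c / 2 * \int[L]_z dotv y z ^+ 2 + (c * 2)^-1 * (expR (quadform S u) - 1).
Proof.
move=> GN u0 q0 DN LR bad merr cL errP errQ stau c0.
have [i1 e0 i2] := centered_finite_variance_dotv y cL.
set V := \int[L]_z _; set q := quadform S u.
have cy := @continuous_dotv _ _ y.
have mdy : measurable_fun [set: borel_cV R k] (dotv y).
  by apply: measurable_continuous_borel_cV.
pose ell (z : 'cV[R]_k) := dotv y z + tau.
have mell : measurable_fun [set: borel_cV R k] ell by apply: measurable_funD.
have cell : continuous ell.
  by move=> z; apply: (@continuousD _ _ _ (dotv y) (fun=> tau)); [exact: cy|exact: cst_continuous].
have iell : L.-integrable [set: borel_cV R k] (EFin \o ell).
  exact: (integrableD measurableT i1 (finite_measure_integrable_cst L tau measurableT)).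
have Eell : \int[L]_z ell z = tau.
  rewrite RintegralD//; last exact: finite_measure_integrable_cst.
  by rewrite e0 Rintegral_cst_probability add0r.
pose gap := c / 2 * V + (c * 2)^-1 * (expR q - 1).
have clipped K : 0 <= K ->
    \int[L]_z clip K (ell z) <= \int[L]_z clip K (dotv y z) + gap.
  move=> K0; pose phi t (w : W t) := clip K (dotv y (err t w)).
  have cf : continuous (fun z => clip K (dotv y z)).
    move=> z; apply: (@continuous_comp _ _ _ (dotv y) (clip K)); first exact: cy.
    exact: continuous_clip.
  have cg : continuous (fun z => clip K (ell z)).
    move=> z; apply: (@continuous_comp _ _ _ ell (clip K)); first exact: cell.
    exact: continuous_clip.
  have cf2 : continuous (fun z => clip K (dotv y z) ^+ 2).
    move=> z; apply: (@continuous_comp _ _ _ (fun z => clip K (dotv y z)) (fun x => x ^+ 2)).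
      exact: cf.
    exact: exprn_continuous.
  have mphi : \forall t \near F, measurable_fun [set: W t] (phi t).
    apply: filterS merr => t mt; apply: (measurableT_comp (@measurable_clip _ K)).
    exact: measurableT_comp mdy mt.
  have phiK t (w : W t) : `|phi t w| <= K by exact: clip_le.
  have cvg1 : \int[P t]_w phi t w @[t --> F] --> \int[L]_z clip K (dotv y z).
    by apply: errP => //; exists K => z; exact: clip_le.
  have cvg2 : \int[P t]_w phi t w ^+ 2 @[t --> F] --> \int[L]_z clip K (dotv y z) ^+ 2.
    apply: (errP (fun z => clip K (dotv y z) ^+ 2)) => //; exists (K ^+ 2) => z.
    by rewrite normrX lerXn2r ?nnegrE ?clip_le.
  (* The hypothesis under [Q] concerns [err - shift], not [err]. In [psi] the moving y'shift is
     replaced by [tau], and the Lipschitz property of [clip] bounds the difference of the integrals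
     by |y'shift - tau|. *)
  have cvgb : \int[Q t]_w phi t w @[t --> F] --> \int[L]_z clip K (ell z).
    pose psi t (w : W t) := clip K (ell (err t w - shift t)).
    have cvgpsi : \int[Q t]_w psi t w @[t --> F] --> \int[L]_z clip K (ell z).
      by apply: (errQ (fun z => clip K (ell z))) => //; exists K => z; exact: clip_le.
    have diff0 : \int[Q t]_w phi t w - \int[Q t]_w psi t w @[t --> F] --> (0 : R).
      have s0 : dotv y (shift t) - tau @[t --> F] --> (0 : R) by exact/subr_cvg0.
      apply/cvgr0Pnorm_le => e egt0; near=> t.
      apply: (@le_trans _ _ `|dotv y (shift t) - tau|); last first.
        by near: t; exact: cvgr0_norm_le s0 _ egt0.
      have mt : measurable_fun [set: W t] (phi t) by near: t.
      have mpsi : measurable_fun [set: W t] (psi t).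
        have me : measurable_fun [set: W t] (err t : W t -> borel_cV R k) by near: t.
        apply: (measurableT_comp (@measurable_clip _ K)).
        rewrite /ell; under eq_fun do rewrite dotvBr.
        apply: measurable_funD => //; apply: measurable_funB => //.
        exact: measurableT_comp mdy me.
      have ip : (Q t).-integrable [set: W t] (EFin \o phi t).
        exact: bounded_integrable (phiK t).
      have ipsi : (Q t).-integrable [set: W t] (EFin \o psi t).
        by apply: bounded_integrable => // w; exact: clip_le.
      have id : (Q t).-integrable [set: W t] (EFin \o (fun w => phi t w - psi t w)).
        exact: (integrableB measurableT ip ipsi).
      rewrite -RintegralB// (le_trans (le_normr_Rintegral _ _))//.
      rewrite -[leRHS](Rintegral_cst_probability (Q t)); apply: le_Rintegral => //.
      + exact: integrable_norm.
      + exact: finite_measure_integrable_cst.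
      move=> w _; rewrite (le_trans (clip_lipschitz _ _ K0))// /ell dotvBr.
      by rewrite [X in `|X| <= _](_ : _ = dotv y (shift t) - tau)//; lra.
    exact: cvg_sub0 diff0 cvgpsi.
  have a2V : \int[L]_z clip K (dotv y z) ^+ 2 <= V.
    apply: le_Rintegral => //.
    + apply: (@bounded_integrable _ _ _ _ _ (K ^+ 2)).
        exact: measurable_continuous_borel_cV.
      by move=> z; rewrite normrX lerXn2r ?nnegrE ?clip_le.
    + by move=> z _; rewrite -ler_sqrt ?sqr_ge0// !sqrtr_sqr normr_clip_le.
  pose m n := \int[N]_z truncated_lr S u n%:R z.
  have cvgm : m n @[n --> \oo] --> (1 : R) by exact: cvg_Rintegral_truncated_lr.
  have rhs_cvg : \int[L]_z clip K (dotv y z) + c / 2 * V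
      + (c * 2)^-1 * (expR q + 1 - m n *+ 2) + K * (1 - m n) @[n --> \oo] -->
      \int[L]_z clip K (dotv y z) + c / 2 * V
      + (c * 2)^-1 * (expR q + 1 - 1 *+ 2) + K * (1 - 1).
    have cvgZ (r : R) (f : nat -> R) (x : R) : f n @[n --> \oo] --> x ->
      r * f n @[n --> \oo] --> r * x by move=> fx; apply: cvgM => //; exact: cvg_cst.
    apply: cvgD; last by apply: cvgZ; apply: cvgD; [exact: cvg_cst|exact: cvgN].
    apply: cvgD; first exact: cvg_cst.
    apply: cvgZ; apply: cvgD; first exact: cvg_cst.
    by apply: cvgN; exact: cvgMn.
  rewrite [leRHS](_ : _ = \int[L]_z clip K (dotv y z) + c / 2 * V
      + (c * 2)^-1 * (expR q + 1 - 1 *+ 2) + K * (1 - 1)); last first.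
    by rewrite /gap mulr2n; lra.
  apply: (ler_cvg_to (cvg_cst _) rhs_cvg); near=> n.
  have n0 : 0 <= n%:R :> R by exact: ler0n.
  have := chapman_robbins_limit (FF := FF) DN LR bad mphi phiK cvg1 cvg2 cvgb n0 c0.
  move=> /le_trans; apply; rewrite lerD2r lerD//.
    by rewrite lerD2l ler_wpM2l// divr_ge0// ltW.
  apply: ler_wpM2l; first by rewrite invr_ge0 mulr_ge0// ltW.
  exact: Rintegral_truncated_lr_sqr_le.
(* As the clipping level grows, the two clipped means tend to [tau] and to 0, the latter because [L]
   is centered. *)
have lim1 := cvg_Rintegral_clip iell; rewrite Eell in lim1.
have lim2 := cvg_Rintegral_clip i1; rewrite e0 in lim2.
rewrite -/gap -[gap]add0r.
apply: (ler_cvg_to lim1 (cvgD lim2 (cvg_cst gap))).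
by apply: nearW => n; exact: clipped.
Unshelve. all: by end_near.
Qed.

(** * The filter of times tending to infinity *)

Lemma at_infty_properfilter {R : realType} (time : set R) :
  (forall A : R, exists2 T, time T & A < T) -> ProperFilter (at_infty time).
Proof.
move=> unb; split; last by rewrite /at_infty; exact: within_filter.
by move=> [M [_ MT]]; have [T tT MltT] := unb M; exact: MT T MltT tT.
Qed.

Lemma unbounded_time {R : realType} (time : set R) :
  time = range (fun n : nat => n%:R) \/ time = [set t | 0 <= t] ->
  forall A : R, exists2 T, time T & A < T.
Proof.
move=> + A; have An : A < (Num.truncn `|A|).+1%:R.
  by apply: (le_lt_trans (ler_norm A)); rewrite -truncn_le_nat.
by case=> ->; exists (Num.truncn `|A|).+1%:R => //=; eexists.
Qed.

Lemma near_at_infty_gt {R : realType} (time : set R) (A : R) :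
  \forall T \near at_infty time, A < T.
Proof.
by exists A; split => [|T AT _ //]; exact: num_real.
Qed.

Lemma near_at_infty_time {R : realType} (time : set R) :
  \forall T \near at_infty time, time T.
Proof. by exists 0; split => [|T _ //]; exact: num_real. Qed.

(** * Optimal direction, local increments and the small-step limit *)

Lemma normr_dotv_le {R : realType} (k : nat) (y z : 'cV[R]_k) :
  `|dotv y z| <= (\sum_i `|y i 0|) * `|z|.
Proof.
rewrite dotvE (le_trans (ler_norm_sum _ _ _))// mulr_suml.
apply: ler_sum => i _; rewrite normrM ler_wpM2l// {2}/Num.norm/= mx_normrE.
exact: (le_bigmax _ (fun ij => `|z ij.1 ij.2|) (i, 0)).
Qed.

(** A row of the kernel of [S] has zero quadratic form, so positivity forces it to vanish. *)
Lemma symmetric_posdef_unitmx {R : realType} (d : nat) (S : 'M[R]_d) :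
  symmetric_posdef S -> S \in unitmx.
Proof.
move=> [ST Spos]; rewrite -row_free_unit -kermx_eq0; apply/eqP/row_matrixP => i.
rewrite row0; apply/eqP/negPn/negP => ki0.
have : 0 < quadform S (row i (kermx S))^T.
  apply: Spos; apply: contra ki0 => /eqP/(congr1 trmx); rewrite trmxK trmx0.
  by move=> ->.
by rewrite /quadform trmxK -row_mul mulmx_ker row0 mul0mx mxE ltxx.
Qed.

(** When nonzero, this [u] maximizes (y'Ju)^2 / u'Su by Cauchy-Schwarz. One number then describes
    both the shift and the information along [u]. *)
Lemma information_direction {R : realType} (d k : nat) (S : 'M[R]_d) (J : 'M[R]_(k, d))
    (y : 'cV[R]_k) : symmetric_posdef S ->
  let u := invmx S *m J^T *m y in
  dotv y (J *m u) = quadform (J *m invmx S *m J^T) y /\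
  quadform S u = quadform (J *m invmx S *m J^T) y.
Proof.
move=> PS u; have SU := symmetric_posdef_unitmx PS; have [ST _] := PS.
split; first by rewrite /dotv /quadform /u !mulmxA.
rewrite /quadform /u !trmx_mul trmxK trmx_inv ST !mulmxA.
by rewrite -[_ *m invmx S *m S]mulmxA mulVmx// mulmx1.
Qed.

(** The remainder of the first-order expansion is at most e' |u| / sqrt T, and the factor sqrt T
    leaves e' |u|. Differentiability is relative to [D], so the perturbed points must eventually lie
    in [D]. *)
Lemma cvg_rescaled_increment {R : realType} (d k : nat) (time : set R)
    (D : set 'cV[R]_d) (g : 'cV[R]_d -> 'cV[R]_k) (theta u : 'cV[R]_d)
    (J : 'M[R]_(k, d)) (y : 'cV[R]_k) :
  is_jacobian_within D g theta J ->
  (Num.sqrt T)^-1 @[T --> at_infty time] --> (0 : R) ->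
  (\forall T \near at_infty time, D (theta + (Num.sqrt T)^-1 *: u)) ->
  dotv y (Num.sqrt T *: (g (theta + (Num.sqrt T)^-1 *: u) - g theta))
    @[T --> at_infty time] --> dotv y (J *m u).
Proof.
move=> Jg c0 Du; set C := (\sum_i `|y i 0|) * `|u|.
have C0 : 0 <= C by rewrite mulr_ge0// sumr_ge0.
have FF : Filter (at_infty time) by exact: within_filter.
apply/cvgrPdist_le => e e0; pose e' := e / (C + 1).
have C1 : 0 < C + 1 by rewrite ltr_wpDl.
have e'0 : 0 < e' by rewrite divr_gt0.
have h0 : (Num.sqrt T)^-1 *: u @[T --> at_infty time] --> (0 : 'cV[R]_d).
  by rewrite -(scale0r u); apply: cvgZr_tmp.
have near_h := h0 _ (Jg _ e'0).
near=> T.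
have T0 : 0 < T by near: T; exact: near_at_infty_gt.
have sT : 0 < Num.sqrt T by rewrite sqrtr_gt0.
have DT : D (theta + (Num.sqrt T)^-1 *: u) by near: T.
have bound : `|g (theta + (Num.sqrt T)^-1 *: u) - g theta - J *m ((Num.sqrt T)^-1 *: u)|
    <= e' * `|(Num.sqrt T)^-1 *: u| by move: DT; near: T; exact: near_h.
rewrite distrC -dotvBr.
rewrite [X in dotv y X](_ : _ = Num.sqrt T *: (g (theta + (Num.sqrt T)^-1 *: u) - g theta
    - J *m ((Num.sqrt T)^-1 *: u))); last first.
  by rewrite [RHS]scalerBr -scalemxAr scalerA divff ?gt_eqF// scale1r.
apply: le_trans (normr_dotv_le _ _) _; rewrite normrZ (gtr0_norm sT).
apply: (@le_trans _ _ ((\sum_i `|y i 0|) * (Num.sqrt T * (e' * `|(Num.sqrt T)^-1 *: u|)))).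
  by rewrite ler_wpM2l ?sumr_ge0// ler_wpM2l// ltW.
rewrite normrZ gtr0_norm ?invr_gt0//.
rewrite [leLHS](_ : _ = e' * C); last by rewrite /C; field; rewrite gt_eqF.
rewrite /e' mulrAC ler_pdivrMr// ler_wpM2l ?(ltW e0)//.
by rewrite lerDl.
Unshelve. all: by end_near.
Qed.

Lemma measurable_affine_borel_cV {R : realType} (k : nat) (c : R) (b : 'cV[R]_k) :
  measurable_fun [set: borel_cV R k] ((fun z => c *: (z - b)) : _ -> borel_cV R k).
Proof.
apply: (@measurability _ _ _ (borel_cV R k) setT _ (@open 'cV[R]_k)) => //.
move=> _ [B oB <-]; rewrite setTI; apply: sub_sigma_algebra.
apply: open_comp oB => z _.
apply: (@continuous_comp _ _ _ (fun z : 'cV[R]_k => z - b) (fun z => c *: z)).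
  by apply: (@continuousB _ _ _ id (fun=> b)); [exact: cvg_id|exact: cst_continuous].
exact: scaler_continuous.
Qed.

(** Dividing by [t] and letting it tend to 0 would give s <= V / 2 + s / 2. The proof instead uses
    the hypothesis at a single small [t]. *)
Lemma quadratic_limit {R : realType} (V s : R) : 0 <= V -> 0 < s ->
  (forall t : R, 0 < t -> t * s <= t / 2 * V + (t * 2)^-1 * (expR (t ^+ 2 * s) - 1)) ->
  s <= V.
Proof.
move=> V0 s0 H; rewrite leNgt; apply/negP => Vs.
have sV : 0 < s - V by rewrite subr_gt0.
set a := s - V in sV *.
have s2 : 0 < s ^+ 2 by rewrite exprn_gt0.
have sa : 0 < s * a by rewrite mulr_gt0.
(* The three positive summands of t D add up to a, whence t <= 1, 4 t s <= 1 and 4 t s^2 <= a. *)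
pose D := 4 * s ^+ 2 + 4 * (s * a) + a; pose t := a / D.
have D0 : 0 < D by rewrite /D; lra.
have t0 : 0 < t by rewrite divr_gt0.
have tD : t * (4 * s ^+ 2) + t * (4 * (s * a)) + t * a = a.
  have tDa : t * D = a by rewrite divfK// gt_eqF.
  by rewrite -[RHS]tDa /D; ring.
have p1 : 0 < t * (4 * s ^+ 2) by rewrite mulr_gt0// mulr_gt0.
have p2 : 0 < t * (4 * (s * a)) by rewrite mulr_gt0// mulr_gt0.
have p3 : 0 < t * a by rewrite mulr_gt0.
have t1 : t <= 1 by rewrite -(ler_pM2r sV) mul1r; lra.
have ts : t * s * 4 <= 1.
  rewrite -(ler_pM2r sV) mul1r [leLHS](_ : _ = t * (4 * (s * a))); first lra.
  by ring.
have tt : t ^+ 2 <= t by rewrite expr2 ler_piMl// ltW.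
have t2 : 0 < t ^+ 2 by rewrite exprn_gt0.
have := H t t0; set x := t ^+ 2 * s; set e := expR x => Hx.
have xts : x <= t * s by rewrite ler_wpM2r// ltW.
(* This is exp(-x) >= 1 - x; it bounds (exp(x) - 1) (1 - x) by x. *)
have ex : e * (1 - x) <= 1.
  have e0 : e != 0 by rewrite gt_eqF// expR_gt0.
  by rewrite -[leRHS](mulfV e0) ler_pM2l ?expR_gt0// -expRN expR_ge1Dx.
have Hx2 : 2 * x <= t ^+ 2 * V + (e - 1).
  rewrite -[leRHS](_ : t * 2 * (t / 2 * V + (t * 2)^-1 * (e - 1)) = _); last first.
    by field; rewrite gt_eqF.
  rewrite [leLHS](_ : _ = t * 2 * (t * s)); last by rewrite /x; ring.
  by rewrite ler_pM2l// mulr_gt0.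
have x1 : 0 < 1 - x by lra.
have : 2 * x * (1 - x) <= t ^+ 2 * V * (1 - x) + x.
  apply: (@le_trans _ _ ((t ^+ 2 * V + (e - 1)) * (1 - x))); first by rewrite ler_pM2r.
  rewrite mulrDl lerD2l mulrBl mul1r; lra.
rewrite [leLHS](_ : _ = t ^+ 2 * (2 * s * (1 - x))); last by rewrite {1}/x; ring.
rewrite [leRHS](_ : _ = t ^+ 2 * (V * (1 - x) + s)); last by rewrite {2}/x; ring.
rewrite ler_pM2l// => Hs.
have Vx : 0 <= V * x by rewrite mulr_ge0// mulr_ge0// ltW.
have sx : s * x <= t * s ^+ 2.
  by rewrite [leRHS](_ : _ = s * (t * s)); [rewrite ler_pM2l|ring].
(* Now s - V <= 2 s x - V x <= 2 t s^2 <= a / 2, against a = s - V > 0. *)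
move: Hs; rewrite !mulrBr !mulr1 => Hs.
have aE : a = s - V by [].
lra.
Qed.

(** * The variance bound for the limit law at a fixed x *)

(** The Chapman-Robbins inequality is applied to the alternatives theta + t u / sqrt T, with u the
    optimal direction and c = t. With s the bound to be proved, the shift of the error tends to t s
    and the quadratic form is t^2 s, which is the setting of [quadratic_limit]. *)
Lemma regular_variance_bound {R : realType} (d k : nat) (time : set R)
    {dE : measure_display} {E : measurableType dE}
    (PT : 'cV[R]_d -> forall T, probability (trajectory time E T) R)
    (Theta : set 'cV[R]_d) (S : 'M[R]_d) (theta : 'cV[R]_d)
    (g : 'cV[R]_d -> 'cV[R]_k) (J : 'M[R]_(k, d))
    (ghat : forall T, trajectory time E T -> 'cV[R]_k)
    (L : probability (borel_cV R k) R) (y : 'cV[R]_k) :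
  (forall A : R, exists2 T, time T & A < T) ->
  LAN PT Theta (fun T => (Num.sqrt T)^-1) S theta ->
  is_jacobian_within Theta g theta J ->
  (forall T, time T ->
    measurable_fun [set: trajectory time E T] (ghat T : _ -> borel_cV R k)) ->
  centered_finite_variance L ->
  (forall u : 'cV[R]_d, let theta_ T := theta + (Num.sqrt T)^-1 *: u in
    cvg_in_distribution (at_infty time) (fun T => PT (theta_ T) T)
      (fun T w => Num.sqrt T *: (ghat T w - g (theta_ T))) L) ->
  quadform (J *m invmx S *m J^T) y <= \int[L]_z dotv y z ^+ 2.
Proof.
move=> unb [PS c0 _ [Delta [[N GN DN] LANu]]] Jg mghat cL reg.
have FF := at_infty_properfilter unb.
set s := quadform _ y; set V := \int[L]_z _.
have V0 : 0 <= V by apply: Rintegral_ge0 => z _; exact: sqr_ge0.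
have [sE qE] := information_direction J y PS.
set u := _ *m y in sE qE.
(* If u = 0 the bound is 0. Otherwise s > 0 and u is a direction covered by [centered_gaussian]. *)
have [u0|u0] := eqVneq u 0.
  by rewrite /s -sE u0 mulmx0 /dotv mulmx0 mxE.
have s0 : 0 < s by rewrite /s -qE; have [_] := PS; exact.
pose err T (w : trajectory time E T) := Num.sqrt T *: (ghat T w - g theta).
(* Regularity in the direction 0 gives the limit law under [theta] itself. *)
have errP : cvg_in_distribution (at_infty time) (PT theta) err L.
  have := reg 0; rewrite /=.
  rewrite (_ : (fun T => PT (theta + (Num.sqrt T)^-1 *: 0) T) = PT theta); last first.
    by apply: functional_extensionality_dep => T; rewrite scaler0 addr0.
  rewrite (_ : (fun T w => Num.sqrt T *: (ghat T w - g (theta + (Num.sqrt T)^-1 *: 0))) = err)//.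
  apply: functional_extensionality_dep => T; apply/funext => w.
  by rewrite /err scaler0 addr0.
have merr : \forall T \near at_infty time,
    measurable_fun [set: trajectory time E T] (err T : _ -> borel_cV R k).
  apply: filterS (near_at_infty_time time) => T tT.
  exact: (measurableT_comp (measurable_affine_borel_cV (Num.sqrt T) (g theta))
    (mghat T tT)).
apply: quadratic_limit => // t t0.
have [nearTheta [Lambda [LR bad]]] := LANu (t *: u).
pose shift T := Num.sqrt T *: (g (theta + (Num.sqrt T)^-1 *: (t *: u)) - g theta).
have tu0 : t *: u != 0 by rewrite scaler_eq0 negb_or gt_eqF.
have qtu : quadform S (t *: u) = t ^+ 2 * s by rewrite quadformZ qE.
have errQ : cvg_in_distribution (at_infty time)
    (fun T => PT (theta + (Num.sqrt T)^-1 *: (t *: u)) T)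
    (fun T w => err T w - shift T) L.
  rewrite (_ : (fun T w => err T w - shift T) = (fun T w =>
    Num.sqrt T *: (ghat T w - g (theta + (Num.sqrt T)^-1 *: (t *: u))))).
    exact: reg.
  apply: functional_extensionality_dep => T; apply/funext => w.
  by rewrite /err /shift -scalerBr opprB addrA subrK.
have cvg_shift : dotv y (shift T) @[T --> at_infty time] --> t * s.
  have := cvg_rescaled_increment (y := y) Jg c0 nearTheta.
  by rewrite -scalemxAr {2}/dotv -scalemxAr mxE -/(dotv y (J *m u)) sE.
rewrite -qtu; apply: (chapman_robbins_regular (FF := FF) GN tu0 _ DN LR bad
  merr cL errP errQ cvg_shift t0).
by rewrite qtu mulr_gt0// exprn_gt0.
Qed.

(** * The risk at a fixed x for large times *)

Lemma dotvZr {R : realType} (k : nat) (a : R) (y z : 'cV[R]_k) :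
  dotv y (a *: z) = a * dotv y z.
Proof. by rewrite /dotv -scalemxAr mxE. Qed.

Lemma quadform_sqmx {R : realType} (k : nat) (v y : 'cV[R]_k) :
  quadform (sqmx v) y = dotv y v ^+ 2.
Proof.
rewrite quadformE dotvE expr2 big_distrl; apply: eq_bigr => i _.
by rewrite big_distrr; apply: eq_bigr => j _; rewrite /sqmx mxE big_ord1 !mxE mulrACA.
Qed.

(** The square is unbounded, so weak convergence is applied to its truncations; these lie below it,
    which suffices for a lower bound. *)
Lemma risk_eventually_gt {R : realType} (k : nat) (time : set R)
    {dE : measure_display} {E : measurableType dE}
    (P : forall T, probability (trajectory time E T) R) (g : 'cV[R]_k)
    (ghat : forall T, trajectory time E T -> 'cV[R]_k)
    (L : probability (borel_cV R k) R) (y : 'cV[R]_k) (c : R) :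
  (forall T, time T ->
    measurable_fun [set: trajectory time E T] (ghat T : _ -> borel_cV R k)) ->
  centered_finite_variance L ->
  cvg_in_distribution (at_infty time) P (fun T w => Num.sqrt T *: (ghat T w - g)) L ->
  c < \int[L]_z dotv y z ^+ 2 ->
  \forall T \near at_infty time,
    (c%:E < T%:E * \int[P T]_w (quadform (sqmx (ghat T w - g)%R) y)%:E)%E.
Proof.
move=> mghat cL errP cV; have [_ _ i2] := centered_finite_variance_dotv y cL.
have FF : Filter (at_infty time) by exact: within_filter.
(* A level at which the truncated second moment of [L] already exceeds [c]. *)
have [n _ cn] : \forall n \near \oo, c < \int[L]_z clip n%:R (dotv y z ^+ 2).
  exact: cvgr_gt (cvg_Rintegral_clip i2) _ cV.
have {}cn := cn n (leqnn n).
pose f (z : 'cV[R]_k) := clip n%:R (dotv y z ^+ 2).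
have cf : continuous f.
  move=> z; apply: (@continuous_comp _ _ _ (fun z => dotv y z ^+ 2) (clip n%:R)).
    apply: (@continuous_comp _ _ _ (dotv y) (fun x => x ^+ 2)).
      exact: continuous_dotv.
    exact: exprn_continuous.
  exact: continuous_clip.
have fb z : `|f z| <= n%:R by exact: clip_le.
have cvgf := errP f cf (ex_intro _ n%:R fb).
near=> T.
have T0 : 0 < T by near: T; exact: near_at_infty_gt.
have tT : time T by near: T; exact: near_at_infty_time.
have cT : c < \int[P T]_w f (Num.sqrt T *: (ghat T w - g)).
  by near: T; exact: cvgr_gt cvgf _ cn.
have := measurableT_comp (measurable_affine_borel_cV (Num.sqrt T) g) (mghat T tT).
set err := (_ \o _) => merr.
have mf : measurable_fun [set: trajectory time E T] (f \o err).
  exact: measurableT_comp (measurable_continuous_borel_cV cf) merr.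
have mdy : measurable_fun [set: borel_cV R k] (dotv y).
  by apply: measurable_continuous_borel_cV; exact: continuous_dotv.
have ifT : (P T).-integrable [set: trajectory time E T] (EFin \o (f \o err)).
  by apply: (@bounded_integrable _ _ _ _ _ n%:R) => // w; exact: fb.
have m2 : measurable_fun [set: trajectory time E T] (fun w => (dotv y (err w) ^+ 2)%:E).
  apply/measurable_EFinP; apply: measurable_funX; exact: measurableT_comp mdy merr.
have errE w : dotv y (err w) ^+ 2 = T * quadform (sqmx (ghat T w - g)) y.
  by rewrite quadform_sqmx /err /= dotvZr exprMn sqr_sqrtr// ltW.
have mq : measurable_fun [set: trajectory time E T]
    (fun w => (quadform (sqmx (ghat T w - g)) y)%:E).
  rewrite (_ : (fun w => _) = (fun w => T^-1%:E * (dotv y (err w) ^+ 2)%:E)%E).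
    exact: measurable_funeM.
  by apply/funext => w; rewrite errE -EFinM mulKf// gt_eqF.
rewrite -ge0_integralZl//; last 2 first.
- by move=> w _; rewrite lee_fin quadform_sqmx sqr_ge0.
- by rewrite lee_fin ltW.
apply: (@lt_le_trans _ _ (\int[P T]_w (f (err w))%:E)%E).
  by rewrite -[ltRHS]fineK ?lte_fin//; exact: integrable_fin_num.
under [leRHS]eq_integral do rewrite -EFinM -errE.
apply: ge0_le_integral => //.
- by move=> w _; rewrite lee_fin /f /clip le_max le_min sqr_ge0 ler0n orbT.
- exact/measurable_EFinP.
- by move=> w _; rewrite lee_fin /f /clip ge_max ge_min lexx (le_trans _ (sqr_ge0 _)) ?oppr_le0.
Unshelve. all: by end_near.
Qed.

(** * Lower limits along sequences of times *)

Lemma le_limn_einf {R : realType} (v : (\bar R)^nat) (c : \bar R) :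
  (\forall n \near \oo, c <= v n)%E -> (c <= limn_einf v)%E.
Proof.
move=> cv; rewrite [leRHS](limf_einfE v \oo); apply: le_trans (ereal_sup_ubound _); last first.
  by exists [set n | (c <= v n)%E].
by apply: le_ereal_inf_tmp => _ [n /= cn <-].
Qed.

Lemma limn_einf_le {R : realType} (v : (\bar R)^nat) (c : \bar R) :
  (forall n, v n <= c)%E -> (limn_einf v <= c)%E.
Proof.
move=> vc; rewrite [leLHS](limf_einfE v \oo); apply: ge_ereal_sup => _ [A Ainf <-].
have [n An] := @filter_ex _ \oo _ A Ainf.
by apply: le_trans (ereal_inf_lbound _) (vc n); exists n.
Qed.

(** Fatou's lemma needs a sequence, while the lower limit runs along a filter. The infimum of [v]
    over the times beyond [n] is below [b], so such a time can be chosen for each [n]. *)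
Lemma limf_einf_lt_sequence {R : realType} (time : set R) (v : R -> \bar R) (b : \bar R) :
  (limf_einf v (at_infty time) < b)%E ->
  exists t : nat -> R,
    [/\ forall n, time (t n), forall n, n%:R < t n & forall n, (v (t n) < b)%E].
Proof.
rewrite limf_einfE => vb.
have /choice[t tP] : forall n : nat, exists T, [/\ time T, n%:R < T & (v T < b)%E].
  move=> n; pose V := [set T | time T /\ n%:R < T].
  have FV : at_infty time V.
    have FF : Filter (at_infty time) by exact: within_filter.
    by apply: filterI; [exact: near_at_infty_time|exact: near_at_infty_gt].
  have : (ereal_inf (v @` V) < b)%E.
    by apply: le_lt_trans vb; apply: ereal_sup_ubound; exists V.
  by move=> /ereal_inf_lt[_ [T [tT nT] <-] vT]; exists T.
by exists t; split => n; have [] := tP n.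
Qed.

Lemma cvg_at_infty {R : realType} (time : set R) (t : nat -> R) :
  (forall n, time (t n)) -> (forall n, n%:R < t n) -> t n @[n --> \oo] --> at_infty time.
Proof.
move=> tt nt A [M [_ MA]]; suff : \forall n \near \oo, A (t n) by [].
near=> n; apply: MA => //.
apply: (le_lt_trans _ (nt n)); near: n; exact: nbhs_infty_ger.
Unshelve. all: by end_near.
Qed.

(** * Integration of the pointwise bound over x *)

Lemma measurable_coord_borel_cV {R : realType} (k : nat) (i : 'I_k) :
  measurable_fun [set: borel_cV R k] (fun z : borel_cV R k => (z : 'cV[R]_k) i 0).
Proof. by apply: measurable_continuous_borel_cV; exact: coord_continuous. Qed.

Theorem proposition2p4 (R : realType) (d k : nat)
  (time : set R)
  (Htime : time = range (fun n : nat => n%:R) \/ time = [set t | 0 <= t])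
  (dE dO : measure_display) (E : measurableType dE) (Omega : measurableType dO)
  (X : R -> {mfun Omega >-> E}) (Y : R -> {mfun Omega >-> borel_cV R k})
  (Theta : set 'cV[R]_d) (P : 'cV[R]_d -> probability Omega R)
  (r : E -> 'cV[R]_d -> 'cV[R]_k) (Jr : E -> 'cV[R]_d -> 'M[R]_(k, d))
  (mu : 'cV[R]_d -> {measure set E -> \bar R})
  (I : 'cV[R]_d -> 'M[R]_d)
  (rhat : forall T, E -> trajectory time E T -> 'cV[R]_k)
  (Hregression : forall theta T, Theta theta -> time T ->
     is_regression (P theta) (X T) (Y T) (fun x => r x theta))
  (Hmeas : measurable_on_Theta Theta r)
  (Hdiff : forall x theta, Theta theta ->
     is_jacobian_within Theta (r x) theta (Jr x theta))
  (HrL2 : forall theta i, Theta theta ->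
     (fun x => r x theta i 0) \in Lfun (mu theta) 2%:E)
  (HJrL2 : forall theta i j, Theta theta ->
     (fun x => Jr x theta i j) \in Lfun (mu theta) 2%:E)
  (Hrhat : forall T, time T ->
     measurable_fun [set: E * trajectory time E T]
       (fun p => rhat T p.1 p.2 : borel_cV R k))
  (HLAN : forall theta, Theta theta ->
     LAN (fun theta' => trajectory_law time X (P theta')) Theta
       (fun T => (Num.sqrt T)^-1) (I theta) theta)
  (Hregular : forall theta, Theta theta ->
     {ae mu theta, forall x,
       regular_at (fun theta' => trajectory_law time X (P theta'))
         (r x) (fun T => rhat T x) theta}) :
  forall theta (y : 'cV[R]_k), Theta theta ->
    (limf_einf
      (fun T : R => T%:E * qer_form (mu theta) (trajectory_law time X (P theta) T)
                         (fun x w => (rhat T x w - r x theta)%R) y)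
      (at_infty time)
     >= (quadform
           (\matrix_(i, j) \int[mu theta]_x
              (Jr x theta *m invmx (I theta) *m (Jr x theta)^T) i j) y)%:E)%E.
Proof.
move=> theta y Htheta.
have unb := unbounded_time Htime.
have PS : symmetric_posdef (I theta) by have [] := HLAN theta Htheta.
pose D x := quadform (Jr x theta *m invmx (I theta) *m (Jr x theta)^T) y.
(* Each entry is a finite combination of products of two Jacobian entries in L2. *)
have intD i j : (mu theta).-integrable [set: E]
    (fun x => ((Jr x theta *m invmx (I theta) *m (Jr x theta)^T) i j)%:E).
  under eq_fun do rewrite mxE -sumEFin.
  apply: integrable_sum => // l _.
  under eq_fun do rewrite mxE big_distrl -sumEFin.
  apply: integrable_sum => // m _.
  under eq_fun do rewrite /= mulrAC mulrC EFinM mxE.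
  apply: integrableZl => //.
  by apply/Lfun1_integrable/Lfun2_mul_Lfun1; exact: HJrL2.
have D0 x : 0 <= D x.
  have [_] := information_direction (Jr x theta) y PS; rewrite /D => <-.
  set u := _ *m y; have [->|u0] := eqVneq u 0; first by rewrite /quadform mulmx0 mxE.
  by have [_ pos] := PS; rewrite ltW// pos.
have mD : measurable_fun [set: E] (fun x => (D x)%:E).
  apply/measurable_EFinP; rewrite /D; under eq_fun do rewrite quadformE.
  apply: measurable_sum => i; apply: measurable_sum => j; apply: measurable_funM => //.
  by apply/measurable_EFinP; exact: measurable_int (intD i j).
rewrite -integral_quadform// -/(D _).
set Q := trajectory_law time X (P theta).
have mcoord T : time T -> forall i, measurable_fun [set: E * trajectory time E T]
    (fun p => (rhat T p.1 p.2 - r p.1 theta) i 0).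
  move=> tT i.
  rewrite (_ : (fun p => _) = (fun p => rhat T p.1 p.2 i 0 - r p.1 theta i 0)); last first.
    by apply/funext => p; rewrite !mxE.
  apply: measurable_funB.
    exact: (measurableT_comp (measurable_coord_borel_cV i) (Hrhat T tT)).
  have := HrL2 theta i Htheta; rewrite inE => /andP[]; rewrite inE /= => mr _.
  exact: (measurableT_comp mr measurable_fst).
pose q T p := quadform (sqmx (rhat T p.1 p.2 - r p.1 theta)) y.
have mq T : time T -> measurable_fun [set: E * trajectory time E T] (fun p => (q T p)%:E).
  move=> tT; apply/measurable_EFinP.
  rewrite (_ : q T = (fun p => (\sum_i y i 0 * (rhat T p.1 p.2 - r p.1 theta) i 0) ^+ 2));
    last by apply/funext => p; rewrite /q quadform_sqmx dotvE.
  apply: measurable_funX; apply: measurable_sum => i.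
  by apply: measurable_funM => //; exact: mcoord.
have q0 T p : (0 <= (q T p)%:E)%E by rewrite lee_fin /q quadform_sqmx sqr_ge0.
pose G T x := (T%:E * \int[Q T]_w (q T (x, w))%:E)%E.
have G0 T x : 0 <= T -> (0 <= G T x)%E.
  by move=> T0; rewrite mule_ge0 ?lee_fin// integral_ge0.
have mH T : time T -> measurable_fun [set: E] (fun x => \int[Q T]_w (q T (x, w))%:E)%E.
  by move=> tT; exact: measurable_fun_fubini_tonelli_F (mq T tT) (q0 T).
have mG T : time T -> measurable_fun [set: E] (G T).
  by move=> tT; apply: measurable_funeM; exact: mH.
have intG T : time T -> 0 <= T -> (\int[mu theta]_x G T x =
    T%:E * qer_form (mu theta) (Q T) (fun x w => (rhat T x w - r x theta)%R) y)%E.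
  move=> tT T0; rewrite ge0_integralZl//.
  - by rewrite qer_formE//; exact: mcoord.
  - exact: mH.
  - by move=> x _; exact: integral_ge0.
(* Stated through levels [c < D x], so that it transfers to every sequence of times tending to
   infinity. *)
have pointwise : {ae mu theta, forall x, forall c, c < D x ->
    \forall T \near at_infty time, (c%:E < G T x)%E}.
  apply: filterS (Hregular theta Htheta) => x [L cL reg] c cD.
  have mx T : time T ->
      measurable_fun [set: trajectory time E T] (rhat T x : _ -> borel_cV R k).
    by move=> tT; exact: (measurableT_comp (Hrhat T tT) (pair1_measurable x)).
  have DV := regular_variance_bound y unb (HLAN theta Htheta) (Hdiff x theta Htheta)
    mx cL reg.
  have reg0 : cvg_in_distribution (at_infty time) Q
      (fun T w => Num.sqrt T *: (rhat T x w - r x theta)) L.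
    have := reg 0; rewrite /=.
    rewrite (_ : (fun T => trajectory_law time X (P (theta + (Num.sqrt T)^-1 *: 0)) T) = Q);
      last by apply: functional_extensionality_dep => T; rewrite scaler0 addr0.
    rewrite (_ : (fun T w => Num.sqrt T *: (rhat T x w - r x (theta + (Num.sqrt T)^-1 *: 0)))
      = (fun T w => Num.sqrt T *: (rhat T x w - r x theta)))//.
    by apply: functional_extensionality_dep => T; apply/funext => w; rewrite scaler0 addr0.
  by apply: (risk_eventually_gt mx cL reg0); exact: lt_le_trans DV.
rewrite leNgt; apply/negP => lt_lim.
(* The lower limit is an extended real: the midpoint serves if it is finite, [a - 1] if it is
   -oo. *)
have [b lt_b b_lt] : exists2 b : R, (limf_einf (fun T : R => T%:E *
    qer_form (mu theta) (Q T) (fun x w => (rhat T x w - r x theta)%R) y)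
    (at_infty time) < b%:E)%E & (b%:E < \int[mu theta]_x (D x)%:E)%E.
  move: lt_lim; rewrite integral_quadform// -/(D _); set a := quadform _ y.
  set v := limf_einf _ _; case: v => [v| |].
  - by rewrite lte_fin => va; exists ((v + a) / 2); rewrite lte_fin ?midf_lt.
  - by rewrite ltNge leey.
  - by exists (a - 1); rewrite ?ltNyr// lte_fin ltrBlDr ltrDl.
have [t [tt nt vt]] := limf_einf_lt_sequence lt_b.
have t0 n : 0 <= t n by rewrite ltW// (le_lt_trans _ (nt n)).
have tF := cvg_at_infty tt nt.
have fat := @fatou _ _ _ (mu theta) setT measurableT (fun n => G (t n))
  (fun n => mG _ (tt n)) (fun n x _ => G0 _ x (t0 n)).
suff : (\int[mu theta]_x (D x)%:E <= b%:E)%E by rewrite leNgt b_lt.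
(* The integral of [D] is at most that of the lower limit of [G (t n)], hence by Fatou at most the
   lower limit of the integrals, each of which is below [b] by the choice of [t]. *)
apply: (@le_trans _ _ (\int[mu theta]_x limn_einf (fun n => G (t n) x))%E).
  apply: ae_ge0_le_integral => //.
  - by move=> x _; rewrite lee_fin.
  - by move=> x _; apply: le_limn_einf; apply: nearW => n; exact: G0.
  - rewrite /limn_einf; apply: measurableT_comp => //.
    apply: measurable_fun_limn_esup => n; apply: measurableT_comp => //.
    exact: mG.
  - apply: filterS pointwise => x Dx _.
    apply/lee_subgt0Pr => e e0; apply: le_limn_einf.
    have : \forall n \near \oo, ((D x - e)%:E < G (t n) x)%E.
      by apply: (tF _ (Dx (D x - e) _)); rewrite ltrBlDr ltrDl.
    by apply: filterS => n /ltW; rewrite EFinB.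
apply: (le_trans fat); apply: limn_einf_le => n.
by rewrite intG// ltW.
Qed.
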